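(* Consider the FIR system $y_t = b_1 u_{t-1} + \dots + b_N u_{t-N} + w_t$ satisfying the assumptions below, and run the following procedure (Algorithm 3). Fix a threshold $c_u$ such that $\mathbb{E}[u \mid u > c_u] \neq \mathbb{E}[u]$ and $\mathbb{E}[u \mid u > c_u] \neq (1-N)\mathbb{E}[u]$, where $u$ has the common distribution of the $u_t$, and step sizes $\alpha_j > 0$ with $\sum_j \alpha_j = \infty$, $\sum_j \alpha_j^2 < \infty$. Let $\tau_1 < \tau_2 < \dots$ be the successive times $t \ge 1$ with $u_t > c_u$, and for $n = 1,\dots,N$ and $i \ge 1$ let $d_{n,i} = \frac{1}{i}\sum_{i'=1}^{i} y_{\tau_{i'} + n}$ (computed by the output quantizer). With $\hat{d}_{n,1} = 0$, define for $j \ge 1$ \[ \hat{d}_{n,j+1} = \hat{d}_{n,j} + \alpha_j\,\mathrm{sgn}\big(d_{n,Nj} - \hat{d}_{n,j}\big), \qquad n = 1,\dots,N, \] (only the binary values $\mathrm{sgn}(d_{n,Nj} - \hat d_{n,j})$ being transmitted to the estimator), and \[ \big[\hat{b}_{1,j},\dots,\hat{b}_{N,j}\big]^T = \mathbf{U}^{-1}\big[\hat{d}_{1,j},\dots,\hat{d}_{N,j}\big]^T, \] where $\mathbf{U}$ is the $N\times N$ matrix with all diagonal entries equal to $\mathbb{E}[u \mid u > c_u]$ and all off-diagonal entries equal to $\mathbb{E}[u]$. Then $\hat{b}_{n,j} \to b_n$ almost surely as $j \to \infty$, for every $n = 1,\dots,N$.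
   Context: Standing assumptions: the input and output quantizers have computational and storage capabilities (they can compute the running averages described, with access to the unquantized $u_t$, $y_t$); $\{u_t\}$ and $\{w_t\}$ are i.i.d. sequences, mutually independent, and $w_t$ has zero mean; the model order $N$ is known; the input distribution is known to the estimator (so $\mathbb{E}[u]$ and $\mathbb{E}[u\mid u>c_u]$, assumed to exist, are known). The function $\mathrm{sgn}$ is defined by $\mathrm{sgn}(x) = -1$ for $x < 0$ and $\mathrm{sgn}(x) = 1$ for $x > 0$ (the paper does not specify a value at $0$). *)

(* Defs.v *)
From HB Require Import structures.
From mathcomp Require Import all_boot all_order all_algebra.
From mathcomp Require Import all_classical all_reals all_analysis.
Set Implicit Arguments. Unset Strict Implicit. Unset Printing Implicit Defensive.
Import Order.TTheory GRing.Theory Num.Theory.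
Import numFieldNormedType.Exports.
Local Open Scope classical_set_scope.
Local Open Scope ring_scope.

Definition mutually_independent {d} {T : measurableType d} {R : realType}
  (P : probability T R) {I : eqType} (X : I -> T -> R) : Prop :=
  forall (J : seq I) (B : I -> set R), uniq J ->
    (forall i, measurable (B i)) ->
    P (\bigcap_(i in [set i | i \in J]) (X i @^-1` B i)) =
    (\prod_(i <- J) P (X i @^-1` B i))%E.

Definition cond_mean_above {d} {T : measurableType d} {R : realType}
  (P : probability T R) (X : T -> R) (c : R) : R :=
  fine (\int[P]_(x in [set x | c < X x]) (X x)%:E) / fine (P [set x | c < X x]).

Definition next_hit (p : nat -> bool) (s : nat) : nat :=
  match pselect (exists t, (s < t)%N && p t) with
  | left h => ex_minn h
  | right _ => 0%N
  end.

Fixpoint hit_time (p : nat -> bool) (i : nat) : nat :=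
  match i with
  | 0%N => 0%N
  | i'.+1 => next_hit p (hit_time p i')
  end.

(* FIR output  y_t = sum_{n=1}^N b_n u_{t-n} + w_t ; here b is indexed by
   'I_N with (b k) = b_{k+1}. *)
Definition fir_output {T : Type} {R : realType} (N : nat) (b : 'I_N -> R)
  (u w : int -> T -> R) (om : T) (t : int) : R :=
  \sum_(k < N) b k * u (t - (k.+1)%:Z) om + w t om.

Definition d_avg {T : Type} {R : realType} (N : nat) (b : 'I_N -> R)
  (u w : int -> T -> R) (cu : R) (om : T) (n i : nat) : R :=
  (\sum_(1 <= i' < i.+1)
     fir_output b u w om
       (addn (hit_time (fun t : nat => cu < u t%:Z om) i') n)%:Z) / i%:R.

(* dhat_{n,j} for j >= 1 :  dhat_seq ... n k = \hat d_{n,k+1};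
   \hat d_{n,1} = 0,
   \hat d_{n,j+1} = \hat d_{n,j} + alpha_j sgn(d_{n,Nj} - \hat d_{n,j}). *)
Fixpoint dhat_seq {T : Type} {R : realType} (N : nat) (b : 'I_N -> R)
  (u w : int -> T -> R) (cu : R) (alpha : nat -> R) (om : T) (n k : nat) : R :=
  match k with
  | 0%N => 0
  | k'.+1 =>
      let dh := dhat_seq b u w cu alpha om n k' in
      dh + alpha k * Num.sg (d_avg b u w cu om n (N * k)%N - dh)
  end.

Definition Umat {R : realType} (N : nat) (m1 m0 : R) : 'M[R]_N :=
  \matrix_(i, j) (if i == j then m1 else m0).

(* \hat b_j = U^{-1} \hat d_j, for j >= 1 given as k = j - 1. *)
Definition bhat {T : Type} {R : realType} (N : nat) (b : 'I_N -> R)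
  (u w : int -> T -> R) (cu : R) (alpha : nat -> R) (m1 m0 : R) (om : T)
  (k : nat) : 'cV[R]_N :=
  invmx (Umat N m1 m0) *m
    \col_(n < N) dhat_seq b u w cu alpha om (n.+1) k.

(* Main.v *)
(* For fixed n, the averages d_{n,i} converge almost surely to
   D_n = b_n E[u | u > c] + sum_{k <> n} b_k E[u] = (U b)_n: an average over the
   hitting times is the ratio of the time averages of 1{u_t > c} y_{t+n} and of
   1{u_t > c}, and 1{u_t > c} y_{t+n} is a combination of the sequences
   1{u_t > c} u_{t+s} and 1{u_t > c} w_{t+n}.  The terms of each of these are
   identically distributed and pairwise independent, except possibly at distance
   |s|, which is enough for Etemadi's proof of the strong law of large numbers.
   The sign recursion then tracks D_n because the steps tend to 0 and have
   infinite sum, and U is invertible by the two conditions on c. *)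
Require Import Defs.
From HB Require Import structures.
From mathcomp Require Import all_boot all_order all_algebra.
From mathcomp Require Import all_classical all_reals all_analysis.
From mathcomp Require Import measurable_realfun ring lra zify.
Import Order.TTheory GRing.Theory Num.Theory.
Import numFieldNormedType.Exports.
Local Open Scope classical_set_scope.
Local Open Scope ring_scope.
Set Implicit Arguments. Unset Strict Implicit. Unset Printing Implicit Defensive.

(** * Averages along hitting times and the sign recursion *)

(** [u] and [w] are merely integrable, so variances may be infinite; the second moments that are
    controlled are those of truncations. The dependence at distance |s| has one cause: the same u_t
    is the value in one term and decides the indicator in another. A second-moment argument
    tolerates this, because it costs only a factor 3 in the variance bound of a sum. For s = 0 the
    indicator and the value are one variable, so their product is treated as a single function of
    it. The almost sure statements are intersected over countable families; the ratio of averages,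
    the sign recursion and the inversion of U are then deterministic facts about a single
    outcome. *)

Lemma next_hitP (p : nat -> bool) (s : nat) :
  (exists t, (s < t)%N && p t) ->
  [/\ (s < next_hit p s)%N, p (next_hit p s) &
      forall t, (s < t < next_hit p s)%N -> p t = false].
Proof.
move=> ex; rewrite /next_hit; case: pselect => [h|/(_ ex)//].
case: ex_minnP => m /andP[sm pm] mmin; split => // t /andP[st tm].
by apply/negbTE/negP => pt; move: (mmin t); rewrite st pt leqNgt tm => /(_ isT).
Qed.

Lemma hit_time_ge (p : nat -> bool) (i : nat) :
  (forall s, exists t, (s < t)%N && p t) -> (i <= hit_time p i)%N.
Proof.
move=> ex; elim: i => //= i ih.
by have [lt_hit _ _] := next_hitP (ex (hit_time p i)); exact: leq_ltn_trans lt_hit.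
Qed.

(** No time strictly between consecutive hits satisfies [p], so each new hit adds a single term.
    [hit_time p 0] is the starting point 0 rather than a hit, hence both sums start at 1. *)
Lemma sum_hit_time (V : nmodType) (p : nat -> bool) (F : nat -> V) (i : nat) :
  (forall s, exists t, (s < t)%N && p t) ->
  \sum_(1 <= i' < i.+1) F (hit_time p i') =
  \sum_(1 <= t < (hit_time p i).+1 | p t) F t.
Proof.
move=> ex; elim: i => [|i ih]; first by rewrite !big_geq.
rewrite big_nat_recr//= ih.
have [lt_hit p_hit p_gap] := next_hitP (ex (hit_time p i)).
rewrite [RHS](big_cat_nat (n := (hit_time p i).+1))//=; last exact: ltnW.
congr (_ + _); rewrite big_mkcond/= big_nat_recr//= p_hit.
by rewrite big_nat_cond big1 ?add0r// => t /andP[/p_gap ->].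
Qed.

(** At time [hit_time p i] exactly [i] hits have occurred, so the average over hits is the quotient
    of the two time averages evaluated there. *)
Lemma cvg_hit_average (R : realType) (p : nat -> bool) (F : nat -> R) (q m : R) :
  0 < q ->
  (fun n => (\sum_(1 <= t < n.+1 | p t) 1) / n%:R) @ \oo --> q ->
  (fun n => (\sum_(1 <= t < n.+1 | p t) F t) / n%:R) @ \oo --> q * m ->
  (fun i => (\sum_(1 <= i' < i.+1) F (hit_time p i')) / i%:R) @ \oo --> m.
Proof.
move=> q0 cvg1 cvgF.
(* Were there no hit after [s], at most [s] hits would ever occur and their frequency would tend to
   0, against [0 < q]. *)
have ex s : exists t, (s < t)%N && p t.
  apply/not_existsP => noh.
  have : (fun n => (\sum_(1 <= t < n.+1 | p t) 1 : R) / n%:R) @ \oo --> (0 : R).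
    apply: (@squeeze_cvgr _ _ _ _ (fun=> 0) (fun n => s%:R / n%:R)).
    - near=> n; apply/andP; split; first by rewrite divr_ge0// sumr_ge0.
      rewrite ler_pM2r; last by rewrite invr_gt0 ltr0n; near: n; exact: nbhs_infty_gt.
      have sn : (s <= n)%N by near: n; exact: nbhs_infty_ge.
      rewrite (big_cat_nat (n := s.+1))//= [X in _ + X]big_nat_cond.
      rewrite [X in _ + X]big1 ?addr0; last first.
        by move=> t /andP[/andP[st _] pt]; case: (noh t); rewrite st.
      rewrite big_mkcond/=.
      rewrite (le_trans (y := \sum_(1 <= t < s.+1) 1))//.
        by apply: ler_sum => t _; case: ifP.
      by rewrite big_const_nat iter_addr addr0 subn1.
    - exact: cvg_cst.
    - rewrite -[X in _ --> X](mulr0 s%:R); apply: cvgMr.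
      apply/gtr0_cvgV0; last exact: cvgr_idn.
      by near=> n; rewrite ltr0n; near: n; exact: nbhs_infty_gt.
  move/(cvg_unique _ cvg1) => q_eq0; by move: q0; rewrite q_eq0// ltxx.
have tau_oo : hit_time p @ \oo --> \oo.
  move=> A [N _ NA]; exists N => // n /= Nn; apply: NA => /=.
  by rewrite (leq_trans Nn)// hit_time_ge.
have : (fun n => (\sum_(1 <= t < n.+1 | p t) F t) / n%:R *
    ((\sum_(1 <= t < n.+1 | p t) 1) / n%:R)^-1) @ \oo --> m.
  have -> : m = q * m / q by rewrite mulrAC divff ?mul1r// lt0r_neq0.
  by apply: cvgM => //; apply: cvgV => //; exact: lt0r_neq0.
move=> /(cvg_comp _ _ tau_oo); apply: cvg_trans; apply: near_eq_cvg; near=> i => /=.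
have i0 : (0 < i)%N by near: i; exact: nbhs_infty_gt.
rewrite -!sum_hit_time// big_const_nat subSS subn0 iter_addr addr0.
rewrite invf_div mulrA mulfVK// pnatr_eq0 -lt0n.
exact: leq_trans (hit_time_ge _ ex).
Unshelve. all: by end_near. Qed.

Lemma cvg_square_series_cvg0 (R : realType) (alpha : nat -> R) :
  cvg ((fun n => \sum_(1 <= j < n) alpha j ^+ 2) @ \oo) ->
  alpha @ \oo --> (0 : R).
Proof.
move=> /cvg_ex[/= l cl].
have cS : (fun n => \sum_(1 <= j < n.+1) alpha j ^+ 2) @ \oo --> l.
  by move: cl; rewrite -(cvg_shiftS (fun n => \sum_(1 <= j < n) alpha j ^+ 2)).
have sq0 : (fun n => alpha n ^+ 2) @ \oo --> (0 : R).
  have lim0 : (fun n => \sum_(1 <= j < n.+1) alpha j ^+ 2 -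
      \sum_(1 <= j < n) alpha j ^+ 2) @ \oo --> (0 : R).
    by rewrite -[X in _ --> X](subrr l); exact: cvgB.
  apply: cvg_trans lim0; apply: near_eq_cvg.
  near=> n; have n0 : (0 < n)%N by near: n; exact: nbhs_infty_gt.
  rewrite /= big_nat_recr//=.
  by rewrite addrAC subrr add0r.
apply/cvgr0Pnorm_lt => e e0.
have /cvgr0Pnorm_lt/(_ _ (exprn_gt0 2 e0)) := sq0.
apply: filterS => n; rewrite normrX.
by rewrite ltr_pXn2r// nnegrE// ltW.
Unshelve. all: by end_near. Qed.

(* The distance to the limit decreases by alpha_k until it drops below e, and
   stays below e from then on. *)
Lemma sign_tracking_cvg (R : realType) (alpha dat x : nat -> R) (D : R) :
  (forall j, (0 < j)%N -> 0 < alpha j) ->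
  (fun n => \sum_(1 <= j < n) alpha j) @ \oo --> +oo ->
  alpha @ \oo --> (0 : R) ->
  dat @ \oo --> D ->
  (forall k, x k.+1 = x k + alpha k.+1 * Num.sg (dat k.+1 - x k)) ->
  x @ \oo --> D.
Proof.
move=> alpha0 alphaoo alphacvg datD xS.
apply/cvgrPdist_le => e e0.
have e20 : 0 < e / 2 by rewrite divr_gt0.
(* Beyond [K] the sign points towards [D] whenever [x] is farther than [e / 2] from it, and each
   step is shorter than [e / 2]. *)
have [K _ HK] : \forall k \near \oo, alpha k < e / 2 /\ `|D - dat k| < e / 2.
  near=> k; split; last first.
    by near: k; move/cvgrPdist_lt : datD; exact.
  apply: le_lt_trans (ler_norm _) _; near: k.
  by move/cvgr0Pnorm_lt : alphacvg; exact.
(* From distance at least [e] a step cannot overshoot [D]; from any closer point it ends within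
   [e]. *)
have step k : (K <= k)%N ->
    `|D - x k.+1| <= Num.max e (`|D - x k| - alpha k.+1).
  move=> Kk; have [/=] := HK k.+1 (leqW Kk); rewrite ltr_norml => ae /andP[d1 d2].
  have a0 := alpha0 k.+1 isT; rewrite xS le_max.
  have [xd|xd|xd] := ltrgt0P (dat k.+1 - x k).
  - rewrite gtr0_sg// mulr1.
    have [h|h] := leP (x k) (D - e); apply/orP; [right|left].
      by rewrite !ger0_norm; lra.
    by rewrite ler_norml; lra.
  - rewrite ltr0_sg// mulrN1.
    have [h|h] := leP (x k) (D + e); apply/orP; [left|right].
      by rewrite ler_norml; lra.
    by rewrite !ler0_norm; lra.
  - rewrite xd sgr0 mulr0 addr0; apply/orP; left.
    by rewrite ler_norml; lra.
have bnd m : `|D - x (K + m)%N| <=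
    Num.max e (`|D - x K| - \sum_(K.+1 <= j < (K + m).+1) alpha j).
  elim: m => [|m ih]; first by rewrite addn0 big_geq// subr0 le_max lexx orbT.
  rewrite addnS (le_trans (step _ (leq_addr _ _)))// big_nat_recr/=; last first.
    by rewrite ltnS leq_addr.
  have a0 := alpha0 (K + m).+1 isT; move: ih; rewrite !ge_max !le_max lexx/=.
  by move=> /orP[h|h]; apply/orP; [left|right]; lra.
(* The steps taken after [K] eventually add up to at least the distance at [K], which makes the
   second argument of the maximum nonpositive. *)
move/cvgryPge : (alphaoo) => /(_ (\sum_(1 <= j < K.+1) alpha j + `|D - x K|)).
move=> [L _ HL]; exists (maxn K L) => // k /=; rewrite geq_max => /andP[Kk Lk].
have := bnd (k - K)%N; rewrite subnKC// => /le_trans; apply.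
rewrite ge_max lexx/= lerBlDr.
have := HL k.+1 (leqW Lk); rewrite /= [leRHS](big_cat_nat (n := K.+1))//= lerD2l => /le_trans; apply.
by rewrite lerDr ltW.
Unshelve. all: by end_near. Qed.

(** * The matrix U *)

(** [Umat] is [m1 - m0] times the identity plus [m0] times the all-ones matrix. *)
Lemma Umat_mul_entry (R : realType) (N : nat) (m1 m0 : R) (v : 'cV[R]_N) i :
  (Umat N m1 m0 *m v) i ord0 = (m1 - m0) * v i ord0 + m0 * \sum_j v j ord0.
Proof.
rewrite mxE mulr_sumr (bigD1 i)//= [in RHS](bigD1 i)//= !mxE eqxx.
rewrite addrA -mulrDl subrK; congr (_ + _); apply: eq_bigr => j ji.
by rewrite mxE eq_sym (negbTE ji).
Qed.

(* U has eigenvalues m1 - m0 and m1 + (N - 1) m0. *)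
Lemma Umat_unit (R : realType) (N : nat) (m1 m0 : R) :
  m1 != m0 -> m1 != (1 - N%:R) * m0 -> Umat N m1 m0 \in unitmx.
Proof.
move=> m10 m1N; rewrite -unitmx_tr -row_free_unit -kermx_eq0.
apply/eqP/row_matrixP => k; rewrite row0; set r := row k _.
have /(congr1 trmx) : r *m (Umat N m1 m0)^T = 0.
  by apply/sub_kermxP; exact: row_sub.
rewrite trmx_mul trmxK trmx0 => Uv0.
have ent i : (m1 - m0) * r^T i ord0 + m0 * \sum_j r^T j ord0 = 0.
  by rewrite -Umat_mul_entry Uv0 mxE.
(* Adding up the rows of U v = 0 gives (m1 + (N - 1) m0) S = 0 for the coordinate sum S; once S = 0,
   each row reduces to (m1 - m0) v_i = 0. *)
have S0 : \sum_j r^T j ord0 = 0.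
  have : \sum_(i < N) ((m1 - m0) * r^T i ord0 + m0 * \sum_j r^T j ord0) = 0.
    by rewrite big1.
  rewrite big_split/= -mulr_sumr sumr_const card_ord -mulr_natr.
  set S := \sum_j _ => h.
  have /eqP : (m1 - (1 - N%:R) * m0) * S = 0 by rewrite -[RHS]h; ring.
  by rewrite mulf_eq0 subr_eq0 (negbTE m1N)/= => /eqP.
apply/rowP => i; have /eqP := ent i.
by rewrite S0 mulr0 addr0 mulf_eq0 subr_eq0 (negbTE m10)/= !mxE => /eqP.
Qed.

Lemma bhat_cvg (T : Type) (R : realType) (N : nat) (b : 'I_N -> R)
    (u w : int -> T -> R) (cu : R) (alpha : nat -> R) (m1 m0 : R) (om : T) :
  m1 != m0 -> m1 != (1 - N%:R) * m0 ->
  (forall n : 'I_N, dhat_seq b u w cu alpha om n.+1 @ \oo -->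
     \sum_(k < N) b k * (if k == n then m1 else m0)) ->
  forall n : 'I_N, (fun k => bhat b u w cu alpha m1 m0 om k n ord0) @ \oo --> b n.
Proof.
move=> m10 m1N dcvg n; have Uu := Umat_unit m10 m1N.
have -> : b n = \sum_(i < N) invmx (Umat N m1 m0) n i *
    (\sum_(k < N) b k * (if k == i then m1 else m0)).
  transitivity ((invmx (Umat N m1 m0) *m (Umat N m1 m0 *m \col_k b k)) n ord0).
    by rewrite mulKmx// mxE.
  rewrite mxE; apply: eq_bigr => i _; congr (_ * _).
  by rewrite mxE; apply: eq_bigr => k _; rewrite !mxE mulrC eq_sym.
rewrite /bhat.
under eq_fun do (rewrite mxE; under eq_bigr do rewrite mxE).
by apply: cvg_big => [|i _]; [exact: add_continuous|apply: cvgMr; exact: dcvg].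
Qed.

(** * Independence of two random variables *)

Definition indep2 {d} {T : measurableType d} {R : realType}
    (P : probability T R) (X Y : T -> R) :=
  forall A B : set R, measurable A -> measurable B ->
    P (X @^-1` A `&` Y @^-1` B) = (P (X @^-1` A) * P (Y @^-1` B))%E.

(** Independence makes the joint law of (X, Y) the product of the two laws; the identity is then
    Tonelli's theorem. *)
Lemma ge0_integral_indep2 {d} {T : measurableType d} {R : realType}
    (P : probability T R) (X Y : T -> R) :
  measurable_fun setT X -> measurable_fun setT Y ->
  (forall x, 0 <= X x) -> (forall x, 0 <= Y x) -> indep2 P X Y ->
  (\int[P]_x (X x * Y x)%:E = \int[P]_x (X x)%:E * \int[P]_x (Y x)%:E)%E.
Proof.
move=> mX mY X0 Y0 XY.
have mXY : measurable_fun setT (fun x => (X x, Y x)).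
  exact: measurable_fun_pair.
pose X' : {mfun T >-> R} := HB.pack X (isMeasurableFun.Build _ _ _ _ _ mX).
pose Y' : {mfun T >-> R} := HB.pack Y (isMeasurableFun.Build _ _ _ _ _ mY).
pose Z : {mfun T >-> (R * R)%type} :=
  HB.pack (fun x => (X x, Y x)) (isMeasurableFun.Build _ _ _ _ _ mXY).
(* The absolute values make the integrand nonnegative on the whole plane without changing it at the
   values of (X, Y). *)
pose f (z : R * R) : \bar R := (`|z.1| * `|z.2|)%:E.
have mf : measurable_fun setT f.
  apply/measurable_EFinP; apply: measurable_funM.
    by apply: measurableT_comp => //; exact: measurable_fst.
  by apply: measurableT_comp => //; exact: measurable_snd.
have f0 z : (0 <= f z)%E by rewrite lee_fin mulr_ge0.
have -> : (\int[P]_x (X x * Y x)%:E = \int[distribution P Z]_z f z)%E.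
  rewrite ge0_integral_distribution//; apply: eq_integral => x _ /=.
  by rewrite /f/= !ger0_norm.
have -> : (\int[distribution P Z]_z f z =
           \int[distribution P X' \x distribution P Y']_z f z)%E.
  apply: eq_measure_integral => A mA _.
  apply/esym; apply: product_measure_unique => // B C mB mC.
rewrite fubini_tonelli1//.
have m1 : measurable_fun setT (fun y : R => (`|y|)%:E).
  by apply/measurable_EFinP; exact: normr_measurable.
have IX : (\int[distribution P X']_x (`|x|)%:E = \int[P]_x (X x)%:E)%E.
  rewrite ge0_integral_distribution//=.
  by apply: eq_integral => x _ /=; rewrite ger0_norm.
have IY : (\int[distribution P Y']_x (`|x|)%:E = \int[P]_x (Y x)%:E)%E.
  rewrite ge0_integral_distribution//=.
  by apply: eq_integral => x _ /=; rewrite ger0_norm.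
rewrite -IX -IY -ge0_integralZr//=; last first.
  by apply: integral_ge0 => x _; rewrite lee_fin.
apply: eq_integral => x _; rewrite /fubini_F /f/= -ge0_integralZl//=.
Qed.

(** * Truncation and second moments *)

(** Both sides are integrals against the common law. That law lives on all of R, whereas [f] is
    nonnegative only on the half-line, so [f] is composed with the absolute value. *)
Lemma eq_distribution_integral {d} {T : measurableType d} {R : realType}
    (P : probability T R) (X Y : T -> R) (f : R -> \bar R) :
  measurable_fun setT X -> measurable_fun setT Y ->
  (forall x, 0 <= X x) -> (forall x, 0 <= Y x) ->
  (forall A, measurable A -> P (X @^-1` A) = P (Y @^-1` A)) ->
  measurable_fun setT f -> (forall y, 0 <= y -> (0 <= f y)%E) ->
  (\int[P]_x f (X x) = \int[P]_x f (Y x))%E.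
Proof.
move=> mX mY X0 Y0 XY mf f0; pose g (y : R) := f `|y|.
have mg : measurable_fun setT g.
  by apply: measurableT_comp => //; exact: normr_measurable.
have g0 y : (0 <= g y)%E by exact/f0/normr_ge0.
pose X' : {mfun T >-> R} := HB.pack X (isMeasurableFun.Build _ _ _ _ _ mX).
pose Y' : {mfun T >-> R} := HB.pack Y (isMeasurableFun.Build _ _ _ _ _ mY).
transitivity (\int[distribution P X']_y g y)%E.
  rewrite ge0_integral_distribution//; apply: eq_integral => x _.
  by rewrite /g/= ger0_norm.
transitivity (\int[distribution P Y']_y g y)%E.
  by apply: eq_measure_integral => A mA _; exact: XY.
rewrite ge0_integral_distribution//; apply: eq_integral => x _.
by rewrite /g/= ger0_norm.
Qed.

Definition trunc {R : realType} (a x : R) : R := x * \1_(`]-oo, a]%classic) x.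

Lemma truncE {R : realType} (a x : R) : trunc a x = if x <= a then x else 0.
Proof.
by rewrite /trunc indicE mem_setE in_itv/=; case: ifP; rewrite ?mulr1 ?mulr0.
Qed.

Lemma trunc_ge0 {R : realType} (a x : R) : 0 <= x -> 0 <= trunc a x.
Proof. by move=> x0; rewrite truncE; case: ifP. Qed.

Lemma measurable_trunc {R : realType} (a : R) : measurable_fun setT (trunc a).
Proof. by apply: measurable_funM => //; exact: measurable_indic. Qed.

Lemma indep2_comp {d} {T : measurableType d} {R : realType}
    (P : probability T R) (X Y : T -> R) (f g : R -> R) :
  measurable_fun setT f -> measurable_fun setT g -> indep2 P X Y ->
  indep2 P (f \o X) (g \o Y).
Proof.
move=> mf mg XY A B mA mB; apply: (XY (f @^-1` A) (g @^-1` B)).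
- by rewrite -[X in measurable X]setTI; exact: mf.
- by rewrite -[X in measurable X]setTI; exact: mg.
Qed.

(** For fixed [s] only t = s, t = s + k and t = s - k can contribute; this is the origin of the
    factor 3 in the bounds below. *)
Lemma sum_dist_le3 (R : realType) (n k s : nat) :
  \sum_(t < n) [|| t == s :> nat, t == (s + k)%N :> nat | s == (t + k)%N :> nat]%:R
    <= 3 :> R.
Proof.
have single (m : nat) : \sum_(t < n) (t == m :> nat)%:R <= 1 :> R.
  have [mn|nm] := ltnP m n.
    rewrite (bigD1 (Ordinal mn))//= eqxx big1 ?addr0// => i.
    by rewrite -val_eqE/= => /negbTE ->.
  by rewrite big1// => i _; rewrite ltn_eqF// (leq_trans (ltn_ord i)).
(* For [s < k] the natural subtraction [s - k] is 0, which can only enlarge the upper bound. *)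
apply: (@le_trans _ _ (\sum_(t < n) ((t == s :> nat)%:R + (t == s + k :> nat)%N%:R
    + (t == s - k :> nat)%N%:R))).
  apply: ler_sum => t _.
  have [ts|ts] := boolP (t == s :> nat); first by rewrite /= -addrA lerDl addr_ge0.
  have [tsk|tsk] := boolP (t == s + k :> nat)%N.
    by rewrite /= add0r lerDl.
  have [/eqP stk|stk] := boolP (s == t + k :> nat)%N.
    by rewrite stk addnK eqxx !add0r.
  by rewrite !add0r.
rewrite !big_split/=; have := single s; have := single (s + k)%N.
by have := single (s - k)%N; lra.
Qed.

(* Independence is not required at distance k, because u_t enters both
   1{u_t > c} u_{t+k} and 1{u_{t-k} > c} u_t. *)
Definition indep_off {d} {T : measurableType d} {R : realType}
    (P : probability T R) (k : nat) (X : nat -> T -> R) :=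
  forall s t, s != t -> t != (s + k)%N -> s != (t + k)%N -> indep2 P (X s) (X t).

Definition ident_distr {d} {T : measurableType d} {R : realType}
    (P : probability T R) (X : nat -> T -> R) :=
  forall n A, measurable A -> P (X n @^-1` A) = P (X 0%N @^-1` A).

(** Expand the square: an independent pair contributes m1^2, and each of the at most 3 n remaining
    ordered pairs contributes at most m1^2 + m2. *)
Lemma integral_sqr_sum_trunc {d} {T : measurableType d} {R : realType}
    (P : probability T R) (X : nat -> T -> R) (k n : nat) (a m1 m2 : R) :
  (forall i, measurable_fun setT (X i)) -> (forall i x, 0 <= X i x) ->
  ident_distr P X -> indep_off P k X ->
  (\int[P]_x (trunc a (X 0%N x))%:E = m1%:E)%E ->
  (\int[P]_x (trunc a (X 0%N x) ^+ 2)%:E = m2%:E)%E ->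
  (\int[P]_x ((\sum_(t < n) trunc a (X t x)) ^+ 2)%:E <=
     (3 * n%:R * m2 + (n%:R * m1) ^+ 2)%:E)%E.
Proof.
move=> mX X0 idX indX Em1 Em2.
pose Y t x := trunc a (X t x).
have mY t : measurable_fun setT (Y t).
  by apply: measurableT_comp => //; exact: measurable_trunc.
have Y0 t x : 0 <= Y t x by exact: trunc_ge0.
have idY t A : measurable A -> P (Y t @^-1` A) = P (Y 0%N @^-1` A).
  move=> mA; apply: (idX t (trunc a @^-1` A)).
  by rewrite -[X in measurable X]setTI; exact: measurable_trunc.
have EY1 t : (\int[P]_x (Y t x)%:E = m1%:E)%E.
  by rewrite -Em1; apply: (eq_distribution_integral (X := Y t) (Y := Y 0%N) (f := EFin)) => //; exact: idY.
have EY2 t : (\int[P]_x (Y t x ^+ 2)%:E = m2%:E)%E.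
  rewrite -Em2; apply: (eq_distribution_integral (X := Y t) (Y := Y 0%N)
    (f := fun y => (y ^+ 2)%:E)) => //.
  - exact: idY.
  - by apply/measurable_EFinP; exact: measurable_funX.
  - by move=> y _; rewrite lee_fin sqr_ge0.
pose dep s t := [|| t == s, t == (s + k)%N | s == (t + k)%N].
have m20 : 0 <= m2.
  by rewrite -lee_fin -Em2; apply: integral_ge0 => x _; rewrite lee_fin sqr_ge0.
have EYY s t : (\int[P]_x (Y s x * Y t x)%:E <= (m1 ^+ 2 + m2 * (dep s t)%:R)%:E)%E.
  have [st|] := boolP (dep s t); last first.
    rewrite !negb_or => /and3P[ts tsk stk]; rewrite mulr0 addr0.
    rewrite ge0_integral_indep2//; first by rewrite !EY1 -EFinM.
    apply: (indep2_comp (X := X s) (Y := X t)); try exact: measurable_trunc.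
    by apply: indX => //; rewrite eq_sym.
  (* For a possibly dependent pair, x y <= (x^2 + y^2) / 2 and the equality of laws give the bound
     [m2]. *)
  rewrite mulr1; apply: (@le_trans _ _ m2%:E); last by rewrite lee_fin lerDr sqr_ge0.
  have -> : (m2%:E = \int[P]_x ((Y s x ^+ 2)%:E * 2^-1%:E + (Y t x ^+ 2)%:E * 2^-1%:E))%E.
    rewrite ge0_integralD//=; last 4 first.
    - by move=> x _; rewrite mule_ge0// lee_fin ?sqr_ge0// invr_ge0.
    - apply: emeasurable_funM => //; apply/measurable_EFinP; exact: measurable_funX.
    - by move=> x _; rewrite mule_ge0// lee_fin ?sqr_ge0// invr_ge0.
    - apply: emeasurable_funM => //; apply/measurable_EFinP; exact: measurable_funX.
    rewrite !ge0_integralZr//=; try by [apply/measurable_EFinP; exact: measurable_funX|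
      move=> x _; rewrite lee_fin sqr_ge0|rewrite lee_fin invr_ge0].
    by rewrite !EY2 -EFinM -EFinD; congr _%:E; lra.
  apply: ge0_le_integral => //.
  - by move=> x _; rewrite lee_fin mulr_ge0.
  - by apply/measurable_EFinP; exact: measurable_funM.
  - by apply: emeasurable_funD; apply: emeasurable_funM => //; apply/measurable_EFinP;
      exact: measurable_funX.
  - move=> x _; rewrite -!EFinM -EFinD lee_fin.
    by have := sqr_ge0 (Y s x - Y t x); rewrite sqrrB -mulr_natr; lra.
have -> : (\int[P]_x ((\sum_(t < n) trunc a (X t x)) ^+ 2)%:E =
    \sum_(s < n) \sum_(t < n) \int[P]_x (Y s x * Y t x)%:E)%E.
  under eq_integral => x _.
    rewrite expr2 big_distrlr/= -sumEFin; under eq_bigr do rewrite -sumEFin; over.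
  have mYY s t : measurable_fun setT (fun x => (Y s x * Y t x)%:E).
    by apply/measurable_EFinP; exact: measurable_funM.
  rewrite ge0_integral_sum//=; last 2 first.
  - by move=> s; exact: (emeasurable_sum (index_enum 'I_n) (mYY s)).
  - by move=> s x _; apply: sume_ge0 => t _; rewrite lee_fin; apply: mulr_ge0; exact: Y0.
  apply: eq_bigr => s _; rewrite ge0_integral_sum//=.
  - by move=> t; exact: mYY.
  - by move=> t x _; rewrite lee_fin; apply: mulr_ge0; exact: Y0.
apply: (@le_trans _ _ (\sum_(s < n) \sum_(t < n) (m1 ^+ 2 + m2 * (dep s t)%:R)%:E)%E).
  by apply: lee_sum => s _; apply: lee_sum => t _; exact: EYY.
under eq_bigr do rewrite sumEFin; rewrite sumEFin lee_fin.
apply: (@le_trans _ _ (\sum_(s < n) (n%:R * m1 ^+ 2 + 3 * m2))).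
  apply: ler_sum => s _; rewrite big_split/=; apply: lerD.
    by rewrite sumr_const card_ord mulr_natl.
  by rewrite -mulr_sumr mulrC ler_wpM2r//; exact: sum_dist_le3.
by rewrite sumr_const card_ord -[leLHS]mulr_natl; lra.
Qed.

Lemma integral_sum_trunc {d} {T : measurableType d} {R : realType}
    (P : probability T R) (X : nat -> T -> R) (n : nat) (a m1 : R) :
  (forall i, measurable_fun setT (X i)) -> (forall i x, 0 <= X i x) ->
  ident_distr P X ->
  (\int[P]_x (trunc a (X 0%N x))%:E = m1%:E)%E ->
  (\int[P]_x (\sum_(t < n) trunc a (X t x))%:E = (n%:R * m1)%:E)%E.
Proof.
move=> mX X0 idX Em1.
have mtr t : measurable_fun setT (fun x => (trunc a (X t x))%:E).
  by apply/measurable_EFinP; apply: measurableT_comp => //; exact: measurable_trunc.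
under eq_integral do rewrite -sumEFin.
rewrite ge0_integral_sum//=; last first.
  by move=> t x _; rewrite lee_fin trunc_ge0.
rewrite (eq_bigr (fun=> m1%:E)); last first.
  move=> t _; rewrite -Em1.
  apply: (eq_distribution_integral (X := X t) (Y := X 0%N) (f := EFin \o trunc a)) => //.
  - by move=> A mA; exact: idX.
  - by apply/measurable_EFinP; exact: measurable_trunc.
  - by move=> y y0; rewrite /= lee_fin trunc_ge0.
by rewrite sumEFin sumr_const card_ord mulr_natl.
Qed.

(** The term (n m1)^2 in the second moment cancels against the squared mean, which leaves a variance
    of at most 3 n m2 for Chebyshev's inequality. *)
Lemma chebyshev_sum_trunc {d} {T : measurableType d} {R : realType}
    (P : probability T R) (X : nat -> T -> R) (k n : nat) (a m1 m2 e : R) :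
  (forall i, measurable_fun setT (X i)) -> (forall i x, 0 <= X i x) ->
  ident_distr P X -> indep_off P k X -> 0 < e ->
  (\int[P]_x (trunc a (X 0%N x))%:E = m1%:E)%E ->
  (\int[P]_x (trunc a (X 0%N x) ^+ 2)%:E = m2%:E)%E ->
  (P [set x | (e <= `|\sum_(t < n) trunc a (X t x) - n%:R * m1|)%R]
    <= (e ^- 2 * (3 * n%:R * m2))%:E)%E.
Proof.
move=> mX X0 idX indX e0 Em1 Em2.
pose S x := \sum_(t < n) trunc a (X t x).
have mS : measurable_fun setT S.
  by apply: measurable_sum => t; apply: measurableT_comp => //; exact: measurable_trunc.
have S0 x : 0 <= S x by apply: sumr_ge0 => t _; exact: trunc_ge0.
pose S' : {RV P >-> R} := HB.pack S (isMeasurableFun.Build _ _ _ _ _ mS).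
have ES := integral_sum_trunc n mX X0 idX Em1.
have ES2 := integral_sqr_sum_trunc n mX X0 idX indX Em1 Em2.
set c := n%:R * m1 in ES ES2 *.
have c0 : 0 <= c by rewrite -lee_fin -ES; apply: integral_ge0 => x _; rewrite lee_fin S0.
have := chebyshev S' e0; rewrite expectation_def ES/= => /le_trans; apply.
rewrite EFinM lee_pmul2l//; last by rewrite lte_fin invr_gt0 exprn_gt0.
rewrite /variance unlock.
rewrite (_ : fine ('E_P[S]) = c); last by rewrite (expectation_def S') ES.
rewrite unlock.
rewrite (eq_integral (fun x => ((S x - c) ^+ 2)%:E)); last by move=> x _; rewrite expr2.
have mSc : measurable_fun setT (fun x => ((S x - c) ^+ 2)%:E).
  by apply/measurable_EFinP; apply: measurable_funX; exact: measurable_funB.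
(* Adding 2 c^2, which is the integral of 2 c S, turns (S - c)^2 into S^2 + c^2, so only integrals
   of nonnegative functions are added and nothing is subtracted. *)
rewrite -(@leeD2rE _ (2 * c * c)%:E)//.
rewrite [X in (_ + X <= _)%E](_ : _ = \int[P]_x ((2 * c)%:E * (S x)%:E))%E; last first.
  rewrite ge0_integralZl//; first by rewrite ES.
  - exact/measurable_EFinP.
  - by move=> x _; rewrite lee_fin.
  - by rewrite lee_fin; apply: mulr_ge0.
have mcS : measurable_fun setT (fun x => ((2 * c)%:E * (S x)%:E)%E).
  by apply/measurable_EFinP; apply: measurable_funM.
rewrite -ge0_integralD//=; first last.
- by move=> x _; rewrite -EFinM lee_fin; apply: mulr_ge0 => //; apply: mulr_ge0.
- by move=> x _; rewrite lee_fin sqr_ge0.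
have mS2 : measurable_fun setT (fun x => (S x ^+ 2)%:E).
  by apply/measurable_EFinP; exact: measurable_funX.
rewrite (eq_integral (fun x => ((S x ^+ 2)%:E + (c ^+ 2)%:E)%E)); last first.
  move=> x _; rewrite -EFinM -!EFinD; congr _%:E.
  by ring.
rewrite ge0_integralD//=; last 2 first.
- by move=> x _; rewrite lee_fin sqr_ge0.
- by move=> x _; rewrite lee_fin sqr_ge0.
rewrite integral_cst//= probability_setT mule1 -EFinD.
apply: (le_trans (leeD2r _ ES2)); rewrite -EFinD lee_fin -/c; lra.
Qed.

(** The full and the truncated sums differ only if some X_t with t < n exceeds [a]; the union bound
    accounts for the second term. *)
Lemma sum_deviation {d} {T : measurableType d} {R : realType}
    (P : probability T R) (X : nat -> T -> R) (k n : nat) (a m1 m2 e : R) :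
  (forall i, measurable_fun setT (X i)) -> (forall i x, 0 <= X i x) ->
  ident_distr P X -> indep_off P k X -> 0 < e ->
  (\int[P]_x (trunc a (X 0%N x))%:E = m1%:E)%E ->
  (\int[P]_x (trunc a (X 0%N x) ^+ 2)%:E = m2%:E)%E ->
  (P [set x | (e <= `|\sum_(t < n) X t x - n%:R * m1|)%R]
    <= (e ^- 2 * (3 * n%:R * m2))%:E + n%:R%:E * P [set x | (a < X 0%N x)%R])%E.
Proof.
move=> mX X0 idX indX e0 Em1 Em2.
pose A := [set x | (e <= `|\sum_(t < n) trunc a (X t x) - n%:R * m1|)%R].
pose B (t : nat) := [set x | (a < X t x)%R].
have mlt (c : R) (f : T -> R) : measurable_fun setT f -> measurable [set x | (c < f x)%R].
  move=> mf; rewrite -[X in measurable X]setTI.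
  by rewrite (_ : [set x | (c < f x)%R] = f @^-1` `]c, +oo[%classic);
    [exact: mf|apply/seteqP; split => x /=; rewrite in_itv/= andbT].
have mB t : measurable (B t) by exact: mlt.
have mle (c : R) (f : T -> R) : measurable_fun setT f -> measurable [set x | (c <= f x)%R].
  move=> mf; rewrite -[X in measurable X]setTI.
  by rewrite (_ : [set x | (c <= f x)%R] = f @^-1` `[c, +oo[%classic);
    [exact: mf|apply/seteqP; split => x /=; rewrite in_itv/= andbT].
have mA : measurable A.
  apply: mle; apply: measurableT_comp; first exact: normr_measurable.
  apply: measurable_funB => //; apply: measurable_sum => t.
  by apply: measurableT_comp => //; exact: measurable_trunc.
have mC : measurable [set x | (e <= `|\sum_(t < n) X t x - n%:R * m1|)%R].
  apply: mle; apply: measurableT_comp; first exact: normr_measurable.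
  by apply: measurable_funB => //; apply: measurable_sum => t.
have mU : measurable (\big[setU/set0]_(t < n) B t) by exact: bigsetU_measurable.
apply: (@le_trans _ _ (P (A `|` \big[setU/set0]_(t < n) B t))).
  apply: le_measure; rewrite ?inE//; first exact: measurableU.
  move=> x /= ex; have [noB|/existsNP[t /contrapT Bt]] := pselect (forall t : 'I_n, ~ B t x).
    left; rewrite /A/= (eq_bigr (fun t : 'I_n => X t x))// => t _.
    by rewrite truncE ifT// leNgt; apply/negP/noB.
  by right; rewrite -bigcup_mkord; exists t => //=.
apply: le_trans (measureU2 P mA mU) _; apply: leeD.
  exact: (chebyshev_sum_trunc n mX X0 idX indX e0 Em1 Em2).
apply: le_trans (Boole_inequality P (fun i (_ : (i < n)%N) => mB i)) _.
rewrite (eq_bigr (fun=> (fine (P (B 0%N)))%:E)); last first.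
  move=> t _; rewrite fineK ?fin_num_measure//; have := idX t `]a, +oo[%classic (measurable_itv _).
  by congr (P _ = P _); apply/seteqP; split => x; rewrite /B/= in_itv/= andbT.
rewrite sumEFin sumr_const card_ord -[P [set x | _]]fineK; last first.
  by apply: fin_num_measure; exact: (mB 0%N).
by rewrite -EFinM mulr_natl.
Qed.

(** * The strong law of large numbers *)

(** Terms vanish while the level is below [v] and halve from the first level at or above [v] on, so
    the sum is at most twice its first surviving term. The case distinction in the bound lets the
    induction pass from [c] to [c * 2]. *)
Lemma sum_sqr_trunc_dyadic (R : realType) (v c : R) (L : nat) : 0 <= v -> 0 < c ->
  \sum_(m < L) trunc (c * 2 ^+ m) v ^+ 2 / (c * 2 ^+ m) <=
    if v <= c then 2 * v ^+ 2 / c else 2 * v.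
Proof.
move=> v0; elim: L c => [|L ih] c c0.
  rewrite big_ord0; case: ifP => _; last by rewrite mulr_ge0.
  by apply: divr_ge0; [apply: mulr_ge0 => //; exact: sqr_ge0|exact: ltW].
rewrite big_ord_recl/= expr0 mulr1 truncE.
have c20 : 0 < c * 2 by rewrite mulr_gt0.
have := ih _ c20.
rewrite (eq_bigr (fun m : 'I_L => trunc (c * 2 ^+ (bump 0 m)) v ^+ 2 / (c * 2 ^+ (bump 0 m))));
  last by move=> m _; rewrite /bump/= add1n (exprS 2 m) mulrA.
set S := \sum_(_ < _) _; have [vc|cv] := leP v c.
  rewrite ifT; last by rewrite (le_trans vc)// ler_peMr ?ltW// ltr1n.
  have -> : 2 * v ^+ 2 / (c * 2) = v ^+ 2 / c by field; exact: lt0r_neq0.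
  by rewrite -mulrA; lra.
rewrite expr0n/= mul0r add0r => /le_trans; apply; case: ifP => // vc2.
rewrite ler_pdivrMr// -mulrA ler_pM2l// expr2; exact: ler_wpM2l.
Qed.

(** The levels below [v] form a geometric progression, whose sum stays under twice the largest one.
    The sharper [2 * v - c] closes the induction, as c + (2 v - 2 c) = 2 v - c. *)
Lemma sum_level_dyadic (R : realType) (v c : R) (L : nat) : 0 <= v -> 0 < c ->
  \sum_(m < L) (c * 2 ^+ m) * (c * 2 ^+ m < v)%R%:R <= Num.max 0 (2 * v - c).
Proof.
move=> v0; elim: L c => [|L ih] c c0; first by rewrite big_ord0 le_max lexx.
rewrite big_ord_recl/= expr0 mulr1.
have c20 : 0 < c * 2 by rewrite mulr_gt0.
have := ih _ c20.
rewrite (eq_bigr (fun m : 'I_L => (c * 2 ^+ (bump 0 m)) * (c * 2 ^+ (bump 0 m) < v)%R%:R));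
  last by move=> m _; rewrite /bump/= add1n (exprS 2 m) mulrA.
set S := \sum_(_ < _) _; rewrite !le_max; have [cv|vc] := ltP c v => /orP[h|h];
  rewrite ?mulr1 ?mulr0 ?add0r; apply/orP; [right|right|left|left]; lra.
Qed.

(** The summand is the pointwise form of the bound in [sum_deviation] when the number of terms n and
    the level are both c 2^m and the tolerance is e n. Its total is linear in [v], so a finite first
    moment makes the deviation probabilities summable. *)
Lemma sum_dyadic_weight (R : realType) (v c e : R) (L : nat) :
  0 <= v -> 0 < c -> 0 < e ->
  \sum_(m < L) (3 * e ^- 2 * (trunc (c * 2 ^+ m) v ^+ 2 / (c * 2 ^+ m)) +
     (c * 2 ^+ m) * (c * 2 ^+ m < v)%R%:R) <= (6 * e ^- 2 + 2) * v.
Proof.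
move=> v0 c0 e0; have ie0 : 0 <= e ^- 2 by rewrite invr_ge0 sqr_ge0.
rewrite big_split/= [leRHS]mulrDl; apply: lerD; last first.
  apply: le_trans (sum_level_dyadic L v0 c0) _; rewrite ge_max; apply/andP; split; lra.
rewrite -mulr_sumr [leRHS](_ : _ = 3 * e ^- 2 * (2 * v)); last by ring.
apply: ler_wpM2l; first exact: mulr_ge0.
apply: le_trans (sum_sqr_trunc_dyadic L v0 c0) _; case: ifP => // vc.
rewrite ler_pdivrMr// -mulrA ler_pM2l// expr2; exact: ler_wpM2l.
Qed.

Lemma trunc_integral_fin {d} {T : measurableType d} {R : realType}
    (P : probability T R) (X : T -> R) (a : R) :
  measurable_fun setT X -> (forall x, 0 <= X x) -> 0 <= a ->
  (\int[P]_x (trunc a (X x))%:E)%E \is a fin_num /\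
  (\int[P]_x (trunc a (X x) ^+ 2)%:E)%E \is a fin_num.
Proof.
move=> mX X0 a0.
have mtX : measurable_fun setT (fun x => trunc a (X x)).
  by apply: measurableT_comp => //; exact: measurable_trunc.
have ta x : trunc a (X x) <= a by rewrite truncE; case: ifP.
have bnd (f : T -> R) (c : R) : measurable_fun setT f -> (forall x, 0 <= f x) ->
    (forall x, f x <= c) -> (\int[P]_x (f x)%:E)%E \is a fin_num.
  move=> mf f0 fc; rewrite ge0_fin_numE; last first.
    by apply: integral_ge0 => x _; rewrite lee_fin.
  apply: (@le_lt_trans _ _ (\int[P]_x c%:E)%E).
    apply: ge0_le_integral => //.
    - by move=> x _; rewrite lee_fin.
    - exact/measurable_EFinP.
    - by move=> x _; rewrite lee_fin.
  by rewrite integral_cst//= probability_setT mule1 ltry.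
split; first by apply: (bnd _ a) => // x; exact: trunc_ge0.
apply: (bnd _ (a ^+ 2)) => [|x|x].
- exact: measurable_funX.
- exact: sqr_ge0.
- by rewrite ler_pXn2r// nnegrE// trunc_ge0.
Qed.

(** Borel-Cantelli along n = c 2^m. The centring is the mean truncated at the current level n; its
    convergence to the full mean is the separate [trunc_mean_cvg]. *)
Lemma ae_dyadic_average {d} {T : measurableType d} {R : realType}
    (P : probability T R) (X : nat -> T -> R) (k c : nat) (e : R) :
  (forall i, measurable_fun setT (X i)) -> (forall i x, 0 <= X i x) ->
  ident_distr P X -> indep_off P k X ->
  (\int[P]_x (X 0%N x)%:E < +oo)%E -> (0 < c)%N -> 0 < e ->
  {ae P, forall x, \forall m \near \oo,
     `|(\sum_(t < (c * 2 ^ m)%N) X t x) / (c * 2 ^ m)%N%:R -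
       fine (\int[P]_x (trunc (c * 2 ^ m)%N%:R (X 0%N x))%:E)%E| < e}.
Proof.
move=> mX X0 idX indX EX c0 e0.
pose n m := (c * 2 ^ m)%N.
have n0 m : 0 < (n m)%:R :> R by rewrite ltr0n muln_gt0 c0 expn_gt0.
have nE m : (n m)%:R = c%:R * 2 ^+ m :> R by rewrite natrM natrX.
pose M1 m := fine (\int[P]_x (trunc (n m)%:R (X 0%N x))%:E)%E.
pose M2 m := fine (\int[P]_x (trunc (n m)%:R (X 0%N x) ^+ 2)%:E)%E.
have fin12 m := trunc_integral_fin P (mX 0%N) (X0 0%N) (ltW (n0 m)).
have M1E m : (\int[P]_x (trunc (n m)%:R (X 0%N x))%:E)%E = (M1 m)%:E.
  by rewrite fineK//; have [] := fin12 m.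
have M2E m : (\int[P]_x (trunc (n m)%:R (X 0%N x) ^+ 2)%:E)%E = (M2 m)%:E.
  by rewrite fineK//; have [] := fin12 m.
pose F m := [set x | (e * (n m)%:R <= `|\sum_(t < n m) X t x - (n m)%:R * M1 m|)%R].
have mF m : measurable (F m).
  rewrite -[X in measurable X]setTI.
  rewrite (_ : F m = (fun x => `|\sum_(t < n m) X t x - (n m)%:R * M1 m|) @^-1`
    `[e * (n m)%:R, +oo[%classic).
    apply: measurableT_comp => //; apply: measurable_funB => //.
    by apply: measurable_sum => t.
  by apply/seteqP; split => x /=; rewrite /F/= in_itv/= andbT.
pose w m (v : R) := 3 * e ^- 2 * (trunc (n m)%:R v ^+ 2 / (n m)%:R) +
     (n m)%:R * ((n m)%:R < v)%R%:R.
have w0 m v : 0 <= v -> 0 <= w m v.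
  move=> v0; apply: addr_ge0; apply: mulr_ge0 => //.
    by rewrite mulr_ge0// invr_ge0 sqr_ge0.
  by rewrite divr_ge0// sqr_ge0.
have mlt m : measurable [set x | ((n m)%:R < X 0%N x)%R].
  rewrite -[X in measurable X]setTI.
  rewrite (_ : [set x | ((n m)%:R < X 0%N x)%R] = X 0%N @^-1` `](n m)%:R, +oo[%classic).
    exact: mX.
  by apply/seteqP; split => x /=; rewrite in_itv/= andbT.
have wE m x : ((w m (X 0%N x))%:E = (3 * e ^- 2 / (n m)%:R)%:E * (trunc (n m)%:R (X 0%N x) ^+ 2)%:E
    + (n m)%:R%:E * (\1_[set x | ((n m)%:R < X 0%N x)%R] x)%:E)%E.
  rewrite -!EFinM -EFinD; congr _%:E; rewrite /w indicE; congr (_ + _ * _%:R).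
    by rewrite [in RHS]mulrAC mulrA.
  by congr nat_of_bool; apply/idP/idP; rewrite inE.
have mt2 m : measurable_fun setT (fun x => (trunc (n m)%:R (X 0%N x) ^+ 2)%:E).
  apply/measurable_EFinP; apply: measurable_funX; apply: measurableT_comp => //.
  exact: measurable_trunc.
have mw m : measurable_fun setT (fun x => (w m (X 0%N x))%:E).
  under eq_fun do rewrite wE; apply: emeasurable_funD; apply: emeasurable_funM => //.
  by apply/measurable_EFinP; exact: measurable_indic.
have PF m : (P (F m) <= \int[P]_x (w m (X 0%N x))%:E)%E.
  have en0 : 0 < e * (n m)%:R by exact: mulr_gt0.
  apply: le_trans (sum_deviation (n m) mX X0 idX indX en0 (M1E m) (M2E m)) _.
  under eq_integral do rewrite wE.
  have K0 : 0 <= 3 * e ^- 2 / (n m)%:R.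
    by rewrite divr_ge0// mulr_ge0// invr_ge0 sqr_ge0.
  have g1 x : (0 <= (trunc (n m)%:R (X 0%N x) ^+ 2)%:E)%E by rewrite lee_fin sqr_ge0.
  have g2 x : (0 <= (\1_[set x | ((n m)%:R < X 0%N x)%R] x)%:E :> \bar R)%E by rewrite lee_fin.
  have g3 : measurable_fun setT
      (fun x => (\1_[set x | ((n m)%:R < X 0%N x)%R] x)%:E : \bar R).
    by apply/measurable_EFinP; exact: measurable_indic.
  have g4 x : (0 <= (3 * e ^- 2 / (n m)%:R)%:E * (trunc (n m)%:R (X 0%N x) ^+ 2)%:E)%E.
    exact: mule_ge0.
  have g5 x : (0 <= (n m)%:R%:E * (\1_[set x | ((n m)%:R < X 0%N x)%R] x)%:E :> \bar R)%E.
    by apply: mule_ge0; rewrite ?lee_fin.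
  have g6 : measurable_fun setT
      (fun x => (n m)%:R%:E * (\1_[set x | ((n m)%:R < X 0%N x)%R] x)%:E : \bar R)%E.
    exact: emeasurable_funM.
  have g7 : measurable_fun setT
      (fun x => (3 * e ^- 2 / (n m)%:R)%:E * (trunc (n m)%:R (X 0%N x) ^+ 2)%:E)%E.
    exact: emeasurable_funM.
  rewrite ge0_integralD// !ge0_integralZl//.
  rewrite integral_indic//= setIT M2E -EFinM leeD2r// lee_fin.
  rewrite exprMn le_eqVlt; apply/orP; left; apply/eqP.
  by field; rewrite !lt0r_neq0.
have sumw L : (\sum_(0 <= m < L) \int[P]_x (w m (X 0%N x))%:E <=
    (6 * e ^- 2 + 2)%:E * \int[P]_x (X 0%N x)%:E)%E.
  rewrite -ge0_integral_sum//=; last by move=> m x _; rewrite lee_fin w0.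
  have K0 : 0 <= 6 * e ^- 2 + 2 by rewrite addr_ge0// mulr_ge0// invr_ge0 sqr_ge0.
  have mX0 : measurable_fun setT (fun x => (X 0%N x)%:E) by exact/measurable_EFinP.
  have X00 x : (0 <= (X 0%N x)%:E)%E by rewrite lee_fin.
  have wx0 x : (0 <= \sum_(0 <= m < L) (w m (X 0%N x))%:E)%E.
    by apply: sume_ge0 => m _; rewrite lee_fin w0.
  have KX0 x : (0 <= (6 * e ^- 2 + 2)%:E * (X 0%N x)%:E)%E.
    by rewrite -EFinM lee_fin; apply: mulr_ge0.
  have mKX : measurable_fun setT (fun x => (6 * e ^- 2 + 2)%:E * (X 0%N x)%:E)%E.
    exact: emeasurable_funM.
  have mws : measurable_fun setT (fun x => \sum_(0 <= m < L) (w m (X 0%N x))%:E)%E.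
    exact: emeasurable_sum.
  rewrite -ge0_integralZl//; apply: ge0_le_integral => //.
  move=> x _; rewrite sumEFin -EFinM lee_fin big_mkord.
  under eq_bigr do rewrite /w nE.
  by apply: sum_dyadic_weight; rewrite ?ltr0n.
have : P (lim_sup_set F) = 0%E.
  apply: lim_sup_set_cvg0 => //.
  apply: (@le_lt_trans _ _ ((6 * e ^- 2 + 2)%:E * \int[P]_x (X 0%N x)%:E)%E); last first.
    rewrite lte_mul_pinfty// ?lee_fin.
    by rewrite addr_ge0// mulr_ge0// invr_ge0 sqr_ge0.
  apply: lime_le; first by apply: is_cvg_nneseries => m _ _.
  apply: nearW => L; apply: le_trans (sumw L); apply: lee_sum => m _; exact: PF.
move=> PF0; exists (lim_sup_set F); split => //.
  by apply: bigcapT_measurable => m; apply: bigcup_measurable => j _; exact: mF.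
move=> x /= nonear m _; apply: contrapT => noF; apply: nonear.
exists m => // j /= mj; rewrite ltNge; apply/negP => h; apply: noF; exists j => //.
rewrite /F/=; apply: le_trans (ler_wpM2r (ltW (n0 j)) h) _.
rewrite -[X in _ * X](ger0_norm (ltW (n0 j))) -normrM mulrBl divfK; last exact: (lt0r_neq0 (n0 j)).
by rewrite -/(n j) -/(M1 j) [M1 j * _]mulrC.
Qed.

Lemma trunc_mean_cvg {d} {T : measurableType d} {R : realType}
    (P : probability T R) (X : T -> R) (c : nat) :
  measurable_fun setT X -> (forall x, 0 <= X x) ->
  P.-integrable setT (EFin \o X) -> (0 < c)%N ->
  (fun m => fine (\int[P]_x (trunc (c * 2 ^ m)%N%:R (X x))%:E)%E) @ \oo -->
    fine (\int[P]_x (X x)%:E)%E.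
Proof.
move=> mX X0 iX c0; apply: fine_cvg.
rewrite fineK; last exact: integrable_fin_num.
pose f m x : \bar R := (trunc (c * 2 ^ m)%N%:R (X x))%:E.
have mf m : measurable_fun setT (f m).
  apply/measurable_EFinP; apply: measurableT_comp => //; exact: measurable_trunc.
have mEX : measurable_fun setT (EFin \o X) by exact/measurable_EFinP.
have cf : {ae P, forall x, setT x -> f ^~ x @ \oo --> (EFin \o X) x}.
  (* Since c 2^m >= m, the level eventually passes X x, and from then on truncation changes
     nothing. *)
  apply: aeW => x _; apply: cvg_near_cst; near=> m.
  rewrite /f truncE ifT//.
  apply: (@le_trans _ _ (Num.truncn (X x)).+1%:R); first exact/ltW/Num.Theory.truncnS_gt.
  rewrite ler_nat (@leq_trans (2 ^ m))//; last by rewrite leq_pmull.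
  apply: (@leq_trans m); last by rewrite ltnW// ltn_expl.
  by near: m; exact: nbhs_infty_ge.
have fX : {ae P, forall x m, setT x -> (`|f m x| <= (EFin \o X) x)%E}.
  apply: aeW => x m _; rewrite /= lee_fin ger0_norm ?trunc_ge0// truncE.
  by case: ifP.
by have [_ _] := dominated_convergence measurableT mf mEX cf iX fX.
Unshelve. all: by end_near. Qed.

(** Take [m] to be the integer part of log2 (n / M) and [c] the quotient of [n] by 2^m. This locates
    [n] up to a relative error 1 / M with finitely many values of [c]. *)
Lemma dyadic_bracket (M m0 n : nat) : (0 < M)%N -> (M * 2 ^ m0 <= n)%N ->
  exists c m, [/\ (M <= c <= 2 * M)%N, (m0 <= m)%N & (c * 2 ^ m <= n < c.+1 * 2 ^ m)%N].
Proof.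
move=> M0 Mn; pose q := (n %/ M)%N.
have q_ge : (2 ^ m0 <= q)%N by rewrite /q leq_divRL// mulnC.
have q0 : (0 < q)%N by rewrite (leq_trans _ q_ge)// expn_gt0.
pose m := trunc_log 2 q.
have m_le : (2 ^ m <= q)%N by exact: trunc_logP.
have m_gt : (q < 2 ^ m.+1)%N by exact: trunc_log_ltn.
have p0 : (0 < 2 ^ m)%N by rewrite expn_gt0.
exists (n %/ 2 ^ m)%N, m; split.
- apply/andP; split.
    by rewrite leq_divRL// (leq_trans (leq_mul (leqnn M) m_le))// mulnC leq_divM.
  rewrite -ltnS ltn_divLR//; apply: (@leq_trans (2 * M * 2 ^ m)).
    rewrite -mulnA mulnCA -expnS mulnC -ltn_divLR//.
  by rewrite leq_mul2r leqnSn orbT.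
- by rewrite -ltnS -(@ltn_exp2l 2)//; exact: leq_ltn_trans q_ge m_gt.
- by rewrite leq_divM ltn_ceil.
Qed.

Lemma cvg_dyadic_average (R : realType) (S : nat -> R) (mu : R) :
  {homo S : m n / (m <= n)%N >-> m <= n} -> (forall n, 0 <= S n) -> 0 <= mu ->
  (forall c, (0 < c)%N ->
     (fun m => S (c * 2 ^ m)%N / (c * 2 ^ m)%N%:R) @ \oo --> mu) ->
  (fun n => S n / n%:R) @ \oo --> mu.
Proof.
move=> ndS S0 mu0 Sc; apply/cvgrPdist_le => e' e'0.
pose e := e' / 2; have e0 : 0 < e by rewrite divr_gt0.
(* A block of length 2^m is at most n / M long; this [M] makes its weight (mu + e) 2^m at most e
   n. *)
pose M := (Num.truncn ((mu + e) / e)).+1.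
have Mge : (mu + e) <= e * M%:R.
  by rewrite mulrC -ler_pdivrMr//; exact/ltW/Num.Theory.truncnS_gt.
have M0 : (0 < M)%N by [].
have /choice[N HN] : forall c, exists N, (0 < c)%N -> forall m, (N <= m)%N ->
    `|mu - S (c * 2 ^ m)%N / (c * 2 ^ m)%N%:R| <= e.
  move=> [|c]; first by exists 0%N.
  have /cvgrPdist_le/(_ e e0)[N _ NH] := Sc c.+1 isT.
  by exists N => _ m Nm; exact: NH.
(* Both [c] and [c.+1] are at most 2 M + 1, so one threshold serves all of them. *)
pose m0 := \max_(c < (2 * M + 2)%N) N c.
exists (M * 2 ^ m0)%N => // n /= /(dyadic_bracket M0)[c [m [/andP[Mc cM] m0m /andP[cn nc]]]].
have Nc c' : (c' < 2 * M + 2)%N -> (N c' <= m)%N.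
  move=> c'M; apply: leq_trans m0m.
  by rewrite /m0 (leq_trans _ (leq_bigmax (Ordinal c'M))).
have c0 : (0 < c)%N by exact: leq_trans Mc.
have p0 : 0 < (2 ^ m)%N%:R :> R by rewrite ltr0n expn_gt0.
have n0 : 0 < n%:R :> R.
  by rewrite ltr0n (leq_trans _ cn)// muln_gt0 c0 expn_gt0.
have lo : (mu - e) * (c%:R * (2 ^ m)%N%:R) <= S n.
  apply: le_trans (ndS _ _ cn); rewrite -ler_pdivlMr; last by rewrite mulr_gt0// ltr0n.
  rewrite -natrM.
  have := HN c c0 m (Nc _ _); rewrite ler_distl => /(_ _)/andP[|].
    by rewrite addn2 ltnS (leq_trans cM).
  by rewrite lerBlDr addrC -lerBlDr; lra.
have hi : S n <= (mu + e) * (c.+1%:R * (2 ^ m)%N%:R).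
  apply: le_trans (ndS _ _ (ltnW nc)) _; rewrite -ler_pdivrMr; last by rewrite mulr_gt0// ltr0n.
  rewrite -natrM.
  have := HN c.+1 isT m (Nc _ _); rewrite ler_distl => /(_ _)/andP[|].
    by rewrite addn2 !ltnS.
  by rewrite lerBlDr.
have cnR : c%:R * (2 ^ m)%N%:R <= n%:R :> R by rewrite -natrM ler_nat.
have ncR : n%:R <= (c%:R + 1) * (2 ^ m)%N%:R :> R.
  by rewrite natr1 -natrM ler_nat ltnW.
have McR : M%:R * (2 ^ m)%N%:R <= n%:R :> R.
  by apply: le_trans cnR; rewrite ler_pM2r// ler_nat.
rewrite ler_distl; move: hi; rewrite -natr1 => hi.
set p := (2 ^ m)%N%:R in p0 lo hi cnR ncR McR *.
have ep : (mu + e) * p <= e * n%:R.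
  apply: le_trans (ler_wpM2r (ltW p0) Mge) _.
  by rewrite -mulrA; apply: ler_wpM2l => //; exact: ltW.
have e2 : e' = 2 * e by rewrite /e mulrC divfK.
have mup : mu * p <= e * n%:R.
  by apply: le_trans ep; rewrite mulrDl lerDl mulr_ge0// ltW.
have en0 : 0 <= e * n%:R by rewrite mulr_ge0// ltW.
have ep0 : 0 <= e * p by rewrite mulr_ge0// ltW.
rewrite lerBlDr ler_pdivrMr// -lerBlDr ler_pdivlMr// e2; apply/andP; split.
  have : (mu + e) * (c%:R * p) <= (mu + e) * n%:R.
    by apply: ler_wpM2l => //; rewrite addr_ge0// ltW.
  lra.
(* If [mu <= e] the lower bound is negative and [S0] suffices; otherwise mu - e is positive and the
   upper estimate of [n] may be multiplied by it. *)
have [mue|emu] := leP mu e.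
  apply: le_trans (S0 n); apply: mulr_le0_ge0; first lra.
  exact: ltW.
have : (mu - e) * n%:R <= (mu - e) * ((c%:R + 1) * p).
  by apply: ler_wpM2l => //; rewrite subr_ge0 ltW.
lra.
Qed.

(* Etemadi's argument: truncate the first n variables at level n, bound the
   deviations by Chebyshev along n = c 2^m, and fill the gaps between the values
   c 2^m, M <= c <= 2 M, by monotonicity of the sums. *)
Theorem strong_law {d} {T : measurableType d} {R : realType}
    (P : probability T R) (X : nat -> T -> R) (k : nat) :
  (forall i, measurable_fun setT (X i)) -> (forall i x, 0 <= X i x) ->
  ident_distr P X -> indep_off P k X -> P.-integrable setT (EFin \o X 0%N) ->
  {ae P, forall x, (fun n => (\sum_(t < n) X t x) / n%:R) @ \oo -->
     fine (\int[P]_x (X 0%N x)%:E)%E}.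
Proof.
move=> mX X0 idX indX iX.
have EXoo : (\int[P]_x (X 0%N x)%:E < +oo)%E.
  by rewrite -ge0_fin_numE; [exact: integrable_fin_num|
    apply: integral_ge0 => x _; rewrite lee_fin].
have e0 j : 0 < j.+1%:R^-1 :> R by rewrite invr_gt0.
(* Countably many multipliers [c.+1] and tolerances 1 / (j + 1) leave a single null set. *)
have H := ae_foralln (fun c => ae_foralln (fun j =>
  ae_dyadic_average mX X0 idX indX EXoo (ltn0Sn c) (e0 j))).
apply: filterS H => x Hx.
apply: (@cvg_dyadic_average _ (fun n => \sum_(t < n) X t x)).
- move=> m n mn; rewrite -!(big_mkord xpredT (X ^~ x)).
  by rewrite [leRHS](big_cat_nat (n := m))//= lerDl sumr_ge0.
- by move=> n; exact: sumr_ge0.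
- by rewrite fine_ge0//; apply: integral_ge0 => t _; rewrite lee_fin.
case=> // c _; have M1cvg := trunc_mean_cvg (mX 0%N) (X0 0%N) iX (ltn0Sn c).
set M1 := fun m => _ in M1cvg.
rewrite (_ : (fun m => _) = (fun m => ((\sum_(t < c.+1 * 2 ^ m) X t x) /
    (c.+1 * 2 ^ m)%N%:R - M1 m) + M1 m)); last by apply/funext => m; rewrite subrK.
rewrite -[X in _ --> X]add0r; apply: cvgD => //.
apply/cvgr0Pnorm_lt => e e_gt0.
near \oo => j.
apply: filterS (Hx c j) => m /lt_trans; apply.
near: j; exact: near_infty_natSinv_lt (PosNum e_gt0).
Unshelve. all: by end_near. Qed.

(** * Independent marks *)

Lemma mutually_independent_indep2 {d} {T : measurableType d} {R : realType}
    (P : probability T R) (I : eqType) (xi : I -> T -> R) (i j : I) :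
  mutually_independent P xi -> i != j -> indep2 P (xi i) (xi j).
Proof.
move=> ind ij A B mA mB.
have := ind [:: i; j] (fun h => if h == i then A else B).
rewrite !big_cons big_nil/= mule1 eqxx [j == i]eq_sym (negbTE ij).
rewrite inE ij => /(_ isT) <-; last by move=> h; case: ifP.
congr (P _); apply/seteqP; split => x /=.
  move=> [Ax Bx] h /=; rewrite !inE => /orP[|] /eqP ->; first by rewrite eqxx.
  by rewrite eq_sym (negbTE ij).
move=> H; split.
  by have := H i; rewrite /= eqxx !inE eqxx; exact.
by have := H j; rewrite /= eq_sym (negbTE ij) !inE eqxx orbT; exact.
Qed.

Lemma mutually_independent_pairs {d} {T : measurableType d} {R : realType}
    (P : probability T R) (I : eqType) (xi : I -> T -> R) (i j k l : I)
    (A B C D : set R) :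
  mutually_independent P xi -> uniq [:: i; j; k; l] ->
  measurable A -> measurable B -> measurable C -> measurable D ->
  (P ((xi i @^-1` A `&` xi j @^-1` B) `&` (xi k @^-1` C `&` xi l @^-1` D)) =
   P (xi i @^-1` A `&` xi j @^-1` B) * P (xi k @^-1` C `&` xi l @^-1` D))%E.
Proof.
move=> ind; rewrite /= !inE !negb_or andbT.
move=> /and3P[/and3P[ij ik il] /andP[jk jl] kl] mA mB mC mD.
have ji := ij; have ki := ik; have li := il; have kj := jk; have lj := jl; have lk := kl.
rewrite eq_sym in ji; rewrite eq_sym in ki; rewrite eq_sym in li.
rewrite eq_sym in kj; rewrite eq_sym in lj; rewrite eq_sym in lk.
rewrite !mutually_independent_indep2//.
pose F h := if h == i then A else if h == j then B else if h == k then C else D.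
have Fi : F i = A by rewrite /F eqxx.
have Fj : F j = B by rewrite /F eqxx (negbTE ji).
have Fk : F k = C by rewrite /F eqxx (negbTE ki) (negbTE kj).
have Fl : F l = D by rewrite /F (negbTE li) (negbTE lj) (negbTE lk).
have := ind [:: i; j; k; l] F.
rewrite !big_cons big_nil/= mule1 Fi Fj Fk Fl !inE !negb_or ij ik il jk jl kl.
move=> /(_ isT) E; rewrite -muleA -E; last by move=> h; rewrite /F; do !case: ifP.
congr (P _); apply/seteqP; split => x /=.
  move=> [[Ax Bx] [Cx Dx]] h /=; rewrite !inE.
  by move=> /or4P[] /eqP ->; rewrite ?Fi ?Fj ?Fk ?Fl.
move=> H; have {}H h : h \in [:: i; j; k; l] -> F h (xi h x) by exact: H.
split; split.
- by rewrite -Fi; apply: H; rewrite !inE eqxx.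
- by rewrite -Fj; apply: H; rewrite !inE eqxx !orbT.
- by rewrite -Fk; apply: H; rewrite !inE eqxx !orbT.
- by rewrite -Fl; apply: H; rewrite !inE eqxx !orbT.
Qed.

Lemma indep_setC {d} {T : measurableType d} {R : realType}
    (P : probability T R) (A B : set T) : measurable A -> measurable B ->
  (P (A `&` B) = P A * P B)%E -> (P (~` A `&` B) = P (~` A) * P B)%E.
Proof.
move=> mA mB; rewrite probability_setC//.
have : (P B = P (A `&` B) + P (~` A `&` B))%E.
  rewrite -measureU.
  - by rewrite -setIUl setUv setTI.
  - exact: measurableI.
  - by apply: measurableI => //; exact: measurableC.
  - by rewrite setIACA setICr set0I.
have mCB : measurable (~` A `&` B) by apply: measurableI => //; exact: measurableC.
have mAB : measurable (A `&` B) by exact: measurableI.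
rewrite -(fineK (fin_num_measure P _ mA)) -(fineK (fin_num_measure P _ mB)).
rewrite -(fineK (fin_num_measure P _ mAB)) -(fineK (fin_num_measure P _ mCB)).
rewrite -EFinD -EFinB -!EFinM => -[h1] [h2]; congr _%:E; lra.
Qed.

(** Complements reach the sets that contain 0. Sets avoiding 0 are convenient for products 1_D(x)
    g(y), as their preimages are intersections of one event per factor. *)
Lemma indep2_off0 {d} {T : measurableType d} {R : realType}
    (P : probability T R) (X Y : T -> R) :
  measurable_fun setT X -> measurable_fun setT Y ->
  (forall A B : set R, measurable A -> measurable B -> ~ A 0 -> ~ B 0 ->
    P (X @^-1` A `&` Y @^-1` B) = (P (X @^-1` A) * P (Y @^-1` B))%E) ->
  indep2 P X Y.
Proof.
move=> mX mY off0.
have mpre (Z : T -> R) A : measurable_fun setT Z -> measurable A -> measurable (Z @^-1` A).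
  by move=> mZ mA; rewrite -[X in measurable X]setTI; exact: mZ.
have offX (A B : set R) : measurable A -> measurable B -> ~ B 0 ->
    P (X @^-1` A `&` Y @^-1` B) = (P (X @^-1` A) * P (Y @^-1` B))%E.
  move=> mA mB B0; have [A0|A0] := pselect (A 0); last exact: off0.
  have mA' := measurableC mA; rewrite -(setCK A) -preimage_setC.
  by apply: indep_setC; [exact: mpre|exact: mpre|apply: off0 => //; exact].
move=> A B mA mB; have [B0|B0] := pselect (B 0); last exact: offX.
have mB' := measurableC mB; rewrite -(setCK B) -preimage_setC setIC muleC.
apply: indep_setC; [exact: mpre|exact: mpre|].
by rewrite setIC muleC; apply: offX => //; exact.
Qed.

(** The index [a t] names the variable that decides the indicator, [b t] the one that is averaged.
    Unless t - s is 0, k or -k, four distinct variables are involved, so the two products are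
    independent. *)
Lemma strong_law_marked {d} {T : measurableType d} {R : realType}
    (P : probability T R) (I : eqType) (xi : I -> T -> R) (a b : nat -> I)
    (k : nat) (D : set R) (g : R -> R) :
  (forall i, measurable_fun setT (xi i)) -> mutually_independent P xi ->
  (forall t A, measurable A -> P (xi (a t) @^-1` A) = P (xi (a 0%N) @^-1` A)) ->
  (forall t A, measurable A -> P (xi (b t) @^-1` A) = P (xi (b 0%N) @^-1` A)) ->
  (forall t, a t != b t) ->
  (forall s t, s != t -> t != (s + k)%N -> s != (t + k)%N ->
     uniq [:: a s; b s; a t; b t]) ->
  measurable D -> measurable_fun setT g -> (forall x, 0 <= g x) ->
  P.-integrable setT (EFin \o (g \o xi (b 0%N))) ->
  {ae P, forall x,
    (fun n => (\sum_(t < n) \1_D (xi (a t) x) * g (xi (b t) x)) / n%:R) @ \oo -->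
     fine (P (xi (a 0%N) @^-1` D)) * fine (\int[P]_x (g (xi (b 0%N) x))%:E)%E}.
Proof.
move=> mxi ind ida idb ab abab mD mg g0 ig.
pose Z t x := \1_D (xi (a t) x) * g (xi (b t) x) : R.
have mI : measurable_fun setT (\1_D : R -> R) by exact: measurable_indic.
have mZ t : measurable_fun setT (Z t).
  by apply: measurable_funM; apply: measurableT_comp.
have Z0 t x : 0 <= Z t x by rewrite mulr_ge0.
have mgA (A : set R) : measurable A -> measurable (g @^-1` A).
  by move=> mA; rewrite -[X in measurable X]setTI; exact: mg.
have preZ t (A : set R) : ~ A 0 -> Z t @^-1` A = xi (a t) @^-1` D `&` xi (b t) @^-1` (g @^-1` A).
  move=> A0; apply/seteqP; split => x; rewrite /Z/= indicE.
    have [Dx|nDx] := boolP (xi (a t) x \in D); last by rewrite mul0r.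
    by rewrite mul1r; split => //; rewrite inE in Dx.
  by move=> [Dx Ax]; rewrite mem_set// mul1r.
have idZ : ident_distr P Z.
  have off0 t (A : set R) : measurable A -> ~ A 0 -> P (Z t @^-1` A) = P (Z 0%N @^-1` A).
    move=> mA A0; rewrite !preZ// !mutually_independent_indep2//; try exact: mgA.
    by rewrite ida// idb//; exact: mgA.
  move=> t A mA; have [A0|] := pselect (A 0); last exact: off0.
  have mpre s : measurable (Z s @^-1` ~` A).
    by rewrite -[X in measurable X]setTI; apply: mZ => //; exact: measurableC.
  rewrite -(setCK A) -[Z t @^-1` _]preimage_setC -[Z 0%N @^-1` _]preimage_setC.
  rewrite [LHS]probability_setC// [RHS]probability_setC// off0//.
  exact: measurableC.
have indZ : indep_off P k Z.
  move=> s t st stk tsk; apply: indep2_off0 => // A B mA mB A0 B0; rewrite !preZ//.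
  by apply: mutually_independent_pairs => //; [exact: abab|exact: mgA|exact: mgA].
have iZ : P.-integrable setT (EFin \o Z 0%N).
  apply: le_integrable ig => //; first exact/measurable_EFinP.
  move=> x _; rewrite /= lee_fin !ger0_norm// /Z indicE.
  by case: (_ \in D); rewrite ?mul1r ?mul0r.
have EZ : (\int[P]_x (Z 0%N x)%:E =
    P (xi (a 0%N) @^-1` D) * \int[P]_x (g (xi (b 0%N) x))%:E)%E.
  have mIx : measurable_fun setT ((\1_D : R -> R) \o xi (a 0%N)) by exact: measurableT_comp.
  have mgx : measurable_fun setT (g \o xi (b 0%N)) by exact: measurableT_comp.
  have Ix0 x : 0 <= ((\1_D : R -> R) \o xi (a 0%N)) x by [].
  have gx0 x : 0 <= (g \o xi (b 0%N)) x by exact: g0.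
  have Igx : indep2 P ((\1_D : R -> R) \o xi (a 0%N)) (g \o xi (b 0%N)).
    by apply: indep2_comp => //; exact: mutually_independent_indep2.
  have mpre : measurable (xi (a 0%N) @^-1` D).
    by rewrite -[X in measurable X]setTI; exact: mxi.
  rewrite (ge0_integral_indep2 mIx mgx Ix0 gx0 Igx); congr (_ * _)%E.
  by rewrite -[in RHS](setIT (xi _ @^-1` D)) -integral_indic.
have := strong_law mZ Z0 idZ indZ iZ.
rewrite EZ fineM//; last exact: integrable_fin_num.
apply: fin_num_measure.
by rewrite -[X in measurable X]setTI; exact: mxi.
Qed.

(** Split [g] into positive and negative parts. [U] and [V] represent the two laws, so that limits
    can be expressed through u_0 and w_0 although the sampled times start at 1. *)
Lemma strong_law_marked_signed {d} {T : measurableType d} {R : realType}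
    (P : probability T R) (I : eqType) (xi : I -> T -> R) (a b : nat -> I)
    (U V : T -> R) (k : nat) (D : set R) (g : R -> R) :
  (forall i, measurable_fun setT (xi i)) -> mutually_independent P xi ->
  measurable_fun setT V ->
  (forall t A, measurable A -> P (xi (a t) @^-1` A) = P (U @^-1` A)) ->
  (forall t A, measurable A -> P (xi (b t) @^-1` A) = P (V @^-1` A)) ->
  (forall t, a t != b t) ->
  (forall s t, s != t -> t != (s + k)%N -> s != (t + k)%N ->
     uniq [:: a s; b s; a t; b t]) ->
  measurable D -> measurable_fun setT g ->
  P.-integrable setT (EFin \o (g \o V)) ->
  {ae P, forall x,
    (fun n => (\sum_(t < n) \1_D (xi (a t) x) * g (xi (b t) x)) / n%:R) @ \oo -->
     fine (P (U @^-1` D)) * fine (\int[P]_x (g (V x))%:E)%E}.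
Proof.
move=> mxi ind mV ida idb ab abab mD mg ig.
have nonneg (h : R -> R) : measurable_fun setT h -> (forall x, 0 <= h x) ->
    (forall x, h x <= `|g x|) ->
    P.-integrable setT (EFin \o (h \o V)) /\
    {ae P, forall x,
      (fun n => (\sum_(t < n) \1_D (xi (a t) x) * h (xi (b t) x)) / n%:R) @ \oo -->
      fine (P (U @^-1` D)) * fine (\int[P]_x (h (V x))%:E)%E}.
  move=> mh h0 hg.
  have mhV : measurable_fun setT (h \o V) by exact: measurableT_comp.
  have mhb : measurable_fun setT (h \o xi (b 0%N)) by exact: measurableT_comp.
  have ihV : P.-integrable setT (EFin \o (h \o V)).
    apply: le_integrable ig => //; first exact/measurable_EFinP.
    by move=> x _; rewrite /= lee_fin ger0_norm.
  split => //.
  have Ehb : (\int[P]_x (h (xi (b 0%N) x))%:E = \int[P]_x (h (V x))%:E)%E.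
    apply: (eq_distribution_integral (X := h \o xi (b 0%N)) (Y := h \o V) (f := EFin)) => //.
    - by move=> x /=.
    - by move=> x /=.
    - move=> A mA; apply: (idb 0%N (h @^-1` A)).
      by rewrite -[X in measurable X]setTI; exact: mh.
  have ihb : P.-integrable setT (EFin \o (h \o xi (b 0%N))).
    apply/integrableP; split; first exact/measurable_EFinP.
    rewrite (eq_integral (fun x => (h (xi (b 0%N) x))%:E)); last first.
      by move=> x _; rewrite /= ger0_norm.
    rewrite Ehb -ge0_fin_numE; first exact: integrable_fin_num.
    by apply: integral_ge0 => x _; rewrite lee_fin.
  have ida0 t A : measurable A -> P (xi (a t) @^-1` A) = P (xi (a 0%N) @^-1` A).
    by move=> mA; rewrite !ida.
  have idb0 t A : measurable A -> P (xi (b t) @^-1` A) = P (xi (b 0%N) @^-1` A).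
    by move=> mA; rewrite !idb.
  rewrite -Ehb -(ida 0%N D mD).
  exact: (strong_law_marked mxi ind ida0 idb0 ab abab mD mh h0 ihb).
have gpos x : g^\+ x <= `|g x| by rewrite ge_max ler_norm normr_ge0.
have gneg x : g^\- x <= `|g x| by rewrite ge_max -normrN ler_norm normr_ge0.
have gE x : g x = g^\+ x - g^\- x.
  exact: (esym (congr1 (fun f : R -> R => f x) (funrposBneg g))).
have [ip lawp] := nonneg _ (measurable_funrpos mg) (funrpos_ge0 g) gpos.
have [im lawm] := nonneg _ (measurable_funrneg mg) (funrneg_ge0 g) gneg.
have -> : (\int[P]_x (g (V x))%:E =
    \int[P]_x (g^\+ (V x))%:E - \int[P]_x (g^\- (V x))%:E)%E.
  rewrite -integralB//; apply: eq_integral => x _.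
  by rewrite /= gE EFinB.
rewrite fineB; [|exact: integrable_fin_num|exact: integrable_fin_num].
apply: filterS2 lawp lawm => x xp xm.
rewrite mulrBr (_ : (fun n => _) = (fun n =>
   (\sum_(t < n) \1_D (xi (a t) x) * g^\+ (xi (b t) x)) / n%:R -
   (\sum_(t < n) \1_D (xi (a t) x) * g^\- (xi (b t) x)) / n%:R)); first exact: cvgB.
apply/funext => n; rewrite -mulrBl -sumrB; congr (_ / _).
by apply: eq_bigr => t _; rewrite -mulrBr -gE.
Qed.

(** * Convergence of the output averages *)

Lemma inl_eqE (A B : eqType) (x y : A) : (inl x == inl y :> (A + B)%type) = (x == y).
Proof. by apply/eqP/eqP => [[]|->]. Qed.

Lemma inr_eqE (A B : eqType) (x y : B) : (inr x == inr y :> (A + B)%type) = (x == y).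
Proof. by apply/eqP/eqP => [[]|->]. Qed.

Lemma ae_sampled_lag {d} {T : measurableType d} {R : realType}
    (P : probability T R) (u w : int -> {RV P >-> R}) (cu : R) (sigma : int) :
  mutually_independent P
    (fun i : int + int => match i with inl t => u t : T -> R
                                      | inr t => w t : T -> R end) ->
  (forall t (B : set R), measurable B -> P (u t @^-1` B) = P (u 0 @^-1` B)) ->
  (forall t (B : set R), measurable B -> P (w t @^-1` B) = P (w 0 @^-1` B)) ->
  P.-integrable setT (EFin \o u 0) ->
  (0 < P [set x | (cu < u 0 x)%R])%E ->
  {ae P, forall om,
    (fun n => (\sum_(t < n) \1_`]cu, +oo[ (u t.+1%:Z om) * u (t.+1%:Z + sigma) om) / n%:R)
      @ \oo --> fine (P [set x | (cu < u 0 x)%R]) *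
        (if sigma == 0 then cond_mean_above P (u 0) cu else fine ('E_P[u 0%Z])%E)}.
Proof.
move=> ind idu idw iu p0; set xi := (fun i : int + int => _) in ind.
have mxi i : measurable_fun setT (xi i) by case: i => t /=; exact: measurable_funPT.
have pE : u 0 @^-1` `]cu, +oo[ = [set x | (cu < u 0 x)%R].
  by apply/seteqP; split => x /=; rewrite in_itv/= andbT.
have mD : measurable (`]cu, +oo[ : set R) by exact: measurable_itv.
have inrlE (x y : int) : (inr x == inl y :> (int + int)%type) = false by [].
have [->|sigma0] := eqVneq sigma 0.
  (* At lag 0 the product of indicator and value becomes the single function [g]. The indicator slot
     is filled by the sure event [setT] for a noise variable, whose index differs from that of the
     input. *)
  pose g (y : R) := y * \1_`]cu, +oo[ y.
  have mg : measurable_fun setT g.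
    by apply: measurable_funM => //; exact: measurable_indic.
  have ig : P.-integrable setT (EFin \o (g \o u 0)).
    apply: le_integrable iu => //.
      by apply/measurable_EFinP; apply: measurableT_comp.
    move=> x _; rewrite /= lee_fin /g indicE.
    by case: (_ \in _); rewrite ?mulr1 ?mulr0 ?normr0.
  have := @strong_law_marked_signed _ _ _ P _ xi (fun t => inr t.+1%:Z)
    (fun t => inl t.+1%:Z) (w 0) (u 0) 0 setT g mxi ind (mxi (inl 0))
    (fun t => idw _) (fun t => idu _) _ _ measurableT mg ig.
  have gE : fine (\int[P]_x (g (u 0 x))%:E)%E =
      fine (P [set x | (cu < u 0 x)%R]) * cond_mean_above P (u 0) cu.
    rewrite /cond_mean_above mulrC divfK; last first.
      rewrite gt_eqF// fine_gt0// p0 -ge0_fin_numE//.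
      by apply: fin_num_measure; rewrite -pE -[X in measurable X]setTI; exact: (mxi (inl 0)).
    congr fine; rewrite [RHS]integral_mkcond; apply: eq_integral => x _.
    rewrite patchE /g indicE -pE.
    have -> : (x \in u 0 @^-1` `]cu, +oo[) = (u 0 x \in `]cu, +oo[%classic).
      by apply/idP/idP; rewrite !inE.
    by case: (_ \in _); rewrite ?mulr1 ?mulr0.
  rewrite preimage_setT probability_setT/= mul1r gE => law.
  have {}law := law (fun t => isT).
  apply: filterS (law _) => [x|s t st _ _]; last first.
    by rewrite /= !inE/= !andbT inr_eqE inl_eqE inrlE; move: st; lia.
  apply: cvg_trans; apply: near_eq_cvg; apply: nearW => n.
  congr (_ / _); apply: eq_bigr => t _.
  by rewrite /g/= indicE in_setT mul1r addr0 mulrC.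
(* The variables at distinct times s and t collide only when t - s is sigma or -sigma, hence the
   exceptional distance |sigma|. *)
have := @strong_law_marked_signed _ _ _ P _ xi (fun t => inl t.+1%:Z)
  (fun t => inl (t.+1%:Z + sigma)) (u 0) (u 0) `|sigma|%N `]cu, +oo[%classic id
  mxi ind (mxi (inl 0)) (fun t => idu _) (fun t => idu _) _ _ mD
  (@measurable_id _ _ setT) iu.
rewrite pE -expectation_def; apply.
- by move=> t; rewrite inl_eqE; lia.
- by move=> s t st ts sk; rewrite /= !inE/= !inl_eqE; lia.
Qed.

(** Serves twice: [g] constant 1 gives the frequency of hits, [g] the identity gives the noise term.
    Indicator and value come from different families, so distinct times never interact and the
    exceptional distance is 0. *)
Lemma ae_sampled_noise {d} {T : measurableType d} {R : realType}
    (P : probability T R) (u w : int -> {RV P >-> R}) (cu : R) (sigma : int)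
    (g : R -> R) :
  mutually_independent P
    (fun i : int + int => match i with inl t => u t : T -> R
                                      | inr t => w t : T -> R end) ->
  (forall t (B : set R), measurable B -> P (u t @^-1` B) = P (u 0 @^-1` B)) ->
  (forall t (B : set R), measurable B -> P (w t @^-1` B) = P (w 0 @^-1` B)) ->
  measurable_fun setT g -> P.-integrable setT (EFin \o (g \o w 0)) ->
  {ae P, forall om,
    (fun n => (\sum_(t < n) \1_`]cu, +oo[ (u t.+1%:Z om) * g (w (t.+1%:Z + sigma) om)) / n%:R)
      @ \oo --> fine (P [set x | (cu < u 0 x)%R]) * fine (\int[P]_x (g (w 0 x))%:E)%E}.
Proof.
move=> ind idu idw mg ig; set xi := (fun i : int + int => _) in ind.
have mxi i : measurable_fun setT (xi i) by case: i => t /=; exact: measurable_funPT.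
have pE : u 0 @^-1` `]cu, +oo[ = [set x | (cu < u 0 x)%R].
  by apply/seteqP; split => x /=; rewrite in_itv/= andbT.
have inlrE (x y : int) : (inl x == inr y :> (int + int)%type) = false by [].
have := @strong_law_marked_signed _ _ _ P _ xi (fun t => inl t.+1%:Z)
  (fun t => inr (t.+1%:Z + sigma)) (u 0) (w 0) 0%N `]cu, +oo[%classic g
  mxi ind (mxi (inr 0)) (fun t => idu _) (fun t => idw _) _ _ (measurable_itv _) mg ig.
rewrite pE; apply => // s t st _ _.
by rewrite /= !inE/= inl_eqE inr_eqE inlrE; move: st; lia.
Qed.

Lemma sum_hit_indic (R : realType) (T : Type) (u : int -> T -> R) (cu : R) (om : T)
    (F : nat -> R) (n : nat) :
  \sum_(1 <= t < n.+1 | cu < u t%:Z om) F t =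
  \sum_(t < n) \1_`]cu, +oo[ (u t.+1%:Z om) * F t.+1.
Proof.
rewrite big_mkcond/= big_add1/= big_mkord; apply: eq_bigr => t _.
rewrite indicE mem_setE in_itv/= andbT.
by case: ifP; rewrite ?mul1r ?mul0r.
Qed.

(** With indices from 0, [b j] multiplies the input at time t + (n + 1) - (j + 1) = t + (n - j), so
    lag 0 occurs exactly for j = n. *)
Lemma d_avg_cvg (T : Type) (R : realType) (N : nat) (b : 'I_N -> R)
    (u w : int -> T -> R) (cu : R) (om : T) (q m1 m0 : R) (n : 'I_N) :
  0 < q ->
  (fun k => (\sum_(t < k) \1_`]cu, +oo[ (u t.+1%:Z om) * 1) / k%:R) @ \oo --> q ->
  (forall j : nat, (fun k => (\sum_(t < k) \1_`]cu, +oo[ (u t.+1%:Z om) *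
       u (t.+1%:Z + (n%:Z - j%:Z)) om) / k%:R) @ \oo -->
     q * (if n%:Z - j%:Z == 0 then m1 else m0)) ->
  (fun k => (\sum_(t < k) \1_`]cu, +oo[ (u t.+1%:Z om) *
       w (t.+1%:Z + n.+1%:Z) om) / k%:R) @ \oo --> (0 : R) ->
  (fun i => d_avg b u w cu om n.+1 i) @ \oo -->
    \sum_(k < N) b k * (if k == n then m1 else m0).
Proof.
move=> q0 freq lag noise; rewrite /d_avg.
pose F (t : nat) := fir_output b u w om (t + n.+1)%N%:Z.
apply: (@cvg_hit_average _ (fun t : nat => cu < u t%:Z om) F q) => //.
  by under eq_fun do rewrite sum_hit_indic.
have FE : (fun k => (\sum_(1 <= t < k.+1 | cu < u t%:Z om) F t) / k%:R) = (fun k =>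
    \sum_(j < N) b j * ((\sum_(t < k) \1_`]cu, +oo[ (u t.+1%:Z om) *
       u (t.+1%:Z + (n%:Z - j%:Z)) om) / k%:R) +
    (\sum_(t < k) \1_`]cu, +oo[ (u t.+1%:Z om) *
       w (t.+1%:Z + n.+1%:Z) om) / k%:R).
  apply/funext => k; rewrite sum_hit_indic.
  under [X in _ = X + _]eq_bigr do rewrite mulrA mulr_sumr.
  rewrite -mulr_suml -mulrDl exchange_big/= -big_split/=; congr (_ / _).
  apply: eq_bigr => t _; rewrite /F /fir_output mulrDr mulr_sumr PoszD; congr (_ + _).
  apply: eq_bigr => j _; rewrite mulrCA; congr (_ * (_ * u _ om)); lia.
rewrite FE mulr_sumr -[X in _ --> X]addr0; apply: cvgD => //.
apply: cvg_big => [|j _]; first exact: add_continuous.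
have := lag j; rewrite mulrCA (_ : (n%:Z - j%:Z == 0) = (j == n)); last first.
  by rewrite -val_eqE/=; lia.
exact: cvgMr.
Qed.

Theorem theorem3 (d : measure_display) (T : measurableType d) (R : realType)
  (P : probability T R) (N : nat) (b : 'I_N -> R)
  (u w : int -> {RV P >-> R}) (cu : R) (alpha : nat -> R) :
  (* {u_t} and {w_t} are i.i.d. and mutually independent *)
  mutually_independent P
    (fun i : int + int => match i with inl t => u t : T -> R
                                      | inr t => w t : T -> R end) ->
  (forall t (B : set R), measurable B ->
     P (u t @^-1` B) = P (u 0 @^-1` B)) ->
  (forall t (B : set R), measurable B ->
     P (w t @^-1` B) = P (w 0 @^-1` B)) ->
  (* w has zero mean *)
  P.-integrable setT (EFin \o w 0) -> ('E_P[w 0%Z] = 0)%E ->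
  (* E[u] and E[u | u > c_u] exist *)
  P.-integrable setT (EFin \o u 0) ->
  (0 < P [set x | (cu < u 0 x)%R])%E ->
  (* conditions on the threshold c_u *)
  cond_mean_above P (u 0) cu != fine ('E_P[u 0%Z])%E ->
  cond_mean_above P (u 0) cu != (1 - N%:R) * fine ('E_P[u 0%Z])%E ->
  (* step sizes alpha_j, j >= 1 *)
  (forall j, (0 < j)%N -> 0 < alpha j) ->
  (fun n => \sum_(1 <= j < n) alpha j) @ \oo --> +oo ->
  cvg ((fun n => \sum_(1 <= j < n) alpha j ^+ 2) @ \oo) ->
  {ae P, forall om, forall n : 'I_N,
     (fun k => bhat b u w cu alpha
                 (cond_mean_above P (u 0) cu) (fine ('E_P[u 0%Z])%E) om k n ord0)
       @ \oo --> b n}.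
Proof.
move=> ind idu idw iw Ew iu p0 m1m0 m1N alpha0 alphaoo alpha2.
set m1 := cond_mean_above P (u 0) cu in m1m0 m1N *.
set m0 := fine _ in m1m0 m1N *.
set q := fine (P [set x | (cu < u 0 x)%R]).
have q0 : 0 < q.
  rewrite fine_gt0// p0 -ge0_fin_numE// fin_num_measure//.
  rewrite (_ : [set x | _] = u 0 @^-1` `]cu, +oo[); last first.
    by apply/seteqP; split => x /=; rewrite in_itv/= andbT.
  rewrite -[X in measurable X]setTI.
  exact: (measurable_funPT (u 0)).
have freq : {ae P, forall om,
    (fun n => (\sum_(t < n) \1_`]cu, +oo[ (u t.+1%:Z om) * 1) / n%:R) @ \oo --> q}.
  have i1 : P.-integrable setT (EFin \o ((fun=> 1 : R) \o w 0)).
    exact: finite_measure_integrable_cst.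
  have m1f : measurable_fun [set: R] (fun=> 1 : R) by exact: measurable_cst.
  have law := ae_sampled_noise cu 0 ind idu idw m1f i1.
  apply: filterS law => om.
  by rewrite integral_cst//= probability_setT mule1/= mulr1.
have lag := ae_foralln (fun n : nat => ae_foralln (fun j : nat =>
  ae_sampled_lag (n%:Z - j%:Z) ind idu idw iu p0)).
have noise := ae_foralln (fun n : nat =>
  ae_sampled_noise cu n.+1%:Z ind idu idw (@measurable_id _ _ setT) iw).
apply: filterS3 freq lag noise => om freq lag noise.
apply: bhat_cvg => // n.
have davg := @d_avg_cvg T R N b (fun t => u t) (fun t => w t) cu om q m1 m0 n
  q0 freq (lag n).
(* [dhat_seq] at k is the estimate numbered k + 1, so the required recursion holds by definition. *)
apply: (sign_tracking_cvg (alpha := alpha)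
  (dat := fun k => d_avg b u w cu om n.+1 (N * k)%N)) => //.
- exact: cvg_square_series_cvg0.
(* The existence of [n] in ['I_N] forces N > 0, so the averages sampled at N k have the same
   limit. *)
- have N0 : (0 < N)%N by exact: leq_ltn_trans (ltn_ord n).
  have Noo : (fun k => (N * k)%N) @ \oo --> \oo.
    move=> A [M _ MA]; exists M => // k /= Mk; apply: MA => /=.
    by rewrite (leq_trans Mk)// leq_pmull.
  apply: (cvg_comp _ _ Noo); apply: davg.
  have := noise n; rewrite -expectation_def Ew mulr0.
  exact.
Qed.
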